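(* (1) There are $n+m$ non-isomorphic irreducible $1$-dimensional $P(H_{n,d})$-representations $$\{\mathbb{C}_k\;|\;0\leq k\leq n-1\}\cup\{\mathbb{C}_{k,d}\;|\;0\leq k\leq n-1,\ d\mid k\}.$$ (2) There are $n-m$ non-isomorphic reducible indecomposable $2$-dimensional $P(H_{n,d})$-representations $V_k$, where $0\leq k\leq n-1$, $d\nmid k$, and $V_k$ has a basis $\{v_1,v_2\}$ with module structure given by $$y\cdot v_1=\omega_k v_1,\quad y\cdot v_2=\omega_k v_2,\quad z\cdot v_1=0,\quad z\cdot v_2=v_1.$$ Moreover, the representations listed in (1) and (2) together form a complete list of non-isomorphic (finite dimensional) indecomposable $P(H_{n,d})$-representations.
   Context: Let $K$ be an algebraically closed field of characteristic $0$, let $n,d\geq 2$ be integers with $d\mid n$, put $m=n/d$, and let $q\in K$ be a primitive $d$-th root of unity. The generalized Taft algebra $H_{n,d}=H_{n,d}(q)$ is the $K$-algebra generated by $g,h$ subject to $g^n=1$, $h^d=0$, $hg=qgh$; it is a Hopf algebra of dimension $nd$ with $\Delta(g)=g\otimes g$, $\Delta(h)=1\otimes h+h\otimes g$, $\varepsilon(g)=1$, $\varepsilon(h)=0$, $S(g)=g^{-1}$, $S(h)=-q^{-1}g^{n-1}h$. Modules are finite dimensional left modules; tensor products of $H_{n,d}$-modules are over $K$ with action through $\Delta$. Fix a primitive $n$-th root of unity $\omega\in K$ with $\omega^m=q$. For $1\leq l\leq d$ and $i\in\mathbb{Z}_n=\mathbb{Z}/(n)$, $M(l,i)$ is the $H_{n,d}$-module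 with basis $v_0,\dots,v_{l-1}$ and action $g\cdot v_j=\omega^i q^{-j}v_j$, $h\cdot v_j=v_{j+1}$ for $0\le j\leq l-2$, $h\cdot v_{l-1}=0$. These form a complete list of pairwise non-isomorphic indecomposable $H_{n,d}$-modules. The Green ring $r(H)$ of a Hopf algebra $H$ is the abelian group generated by isomorphism classes $[V]$ of finite dimensional $H$-modules modulo $[V\oplus W]=[V]+[W]$, with multiplication $[V][W]=[V\otimes W]$. The projective class ring $p(H_{n,d})$ is the subring of $r(H_{n,d})$ generated by the classes of projective and of semisimple $H_{n,d}$-modules, and $P(H_{n,d})=\mathbb{C}\otimes_{\mathbb{Z}}p(H_{n,d})$. The algebra $P(H_{n,d})$ is identified with $\mathbb{C}[y,z]/(y^n-1,\ z^2-(1+y^m+y^{2m}+\cdots+y^{(d-1)m})z)$ via $y=[M(1,-1)]$, $z=[M(d,0)]$. For $0\leq k\leq n-1$ put $\omega_k=\cos\frac{2k\pi}{n}+i\sin\frac{2k\pi}{n}\in\mathbb{C}$. $\mathbb{C}_k$ denotes the $P(H_{n,d})$-module $\mathbb{C}$ with $y\cdot 1=\omega_k$, $z\cdot 1=0$; for $d\mid k$, $\mathbb{C}_{k,d}$ denotes the $P(H_{n,d})$-module $\mathbb{C}$ with $y\cdot 1=\omega_k$, $z\cdot 1=d$. *)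

(* Defs.v *)
From HB Require Import structures.
From mathcomp Require Import all_boot all_order all_algebra.
From mathcomp Require Import mxtens complex.
From mathcomp Require Import boolp reals trigo.
Set Implicit Arguments.
Unset Strict Implicit.
Unset Printing Implicit Defensive.
Import Order.TTheory GRing.Theory Num.Theory.
Local Open Scope ring_scope.
Local Open Scope quotient_scope.

(* A formal sum is a list of signed generators; [(true, x)] stands for [x] and
   [(false, x)] for [- x].  [E s t] is read as the relation
   [\sum_(x <- s) x = \sum_(x <- t) x]. *)
Section Presented.
Context {X : choiceType} (E : seq X -> seq X -> Prop).

Definition fpos (s : seq X) : seq (bool * X) := [seq (true, x) | x <- s].
Definition fneg (s : seq (bool * X)) := [seq (~~ p.1, p.2) | p <- s].

Inductive peq : seq (bool * X) -> seq (bool * X) -> Prop :=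
| peq_refl s : peq s s
| peq_sym s t : peq s t -> peq t s
| peq_trans s t u : peq s t -> peq t u -> peq s u
| peq_cat s s' t t' : peq s s' -> peq t t' -> peq (s ++ t) (s' ++ t')
| peq_comm s t : peq (s ++ t) (t ++ s)
| peq_inv b x : peq [:: (b, x); (~~ b, x)] [::]
| peq_rel s t : E s t -> peq (fpos s) (fpos t).

Definition peqb s t := `[< peq s t >].

Lemma peqb_refl : reflexive peqb.
Proof. by move=> s; apply/asboolP; exact: peq_refl. Qed.
Lemma peqb_sym : symmetric peqb.
Proof. by move=> s t; apply/asboolP/asboolP; exact: peq_sym. Qed.
Lemma peqb_trans : transitive peqb.
Proof. by move=> t s u /asboolP a /asboolP b; apply/asboolP; exact: peq_trans a b. Qed.

Canonical peqb_equiv := EquivRel peqb peqb_refl peqb_sym peqb_trans.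

Definition presented := {eq_quot peqb_equiv}.
HB.instance Definition _ := Choice.on presented.
HB.instance Definition _ := EqQuotient.on presented.

Definition pclass (s : seq (bool * X)) : presented := \pi s.

Lemma pclassP s t : pclass s = pclass t <-> peq s t.
Proof. by split=> [/eqquotP/asboolP|h] //; apply/eqquotP/asboolP. Qed.

Lemma pclassK (x : presented) : pclass (repr x) = x.
Proof. by rewrite /pclass reprK. Qed.

Lemma peq_fneg s : peq (fneg s ++ s) [::].
Proof.
elim: s => [|[b x] s IH] /=; first exact: peq_refl.
apply: (@peq_trans _ (([:: (~~ b, x)] ++ [:: (b, x)]) ++ (fneg s ++ s))).
  rewrite -cat1s -/(fneg s) -[(b, x) :: s]cat1s -catA.
  apply: peq_cat; first exact: peq_refl.
  rewrite !catA; apply: peq_cat (peq_refl s); exact: peq_comm.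
rewrite -[[::]](cat0s [::]); apply: peq_cat IH.
have := peq_inv (~~ b) x; by rewrite negbK.
Qed.

Lemma peq_fneg2 s t : peq s t -> peq (fneg s) (fneg t).
Proof.
move=> st.
apply: (@peq_trans _ (fneg s ++ (fneg t ++ t))).
  rewrite -{1}[fneg s]cats0; apply: peq_cat; first exact: peq_refl.
  exact/peq_sym/peq_fneg.
apply: (@peq_trans _ ((fneg s ++ s) ++ fneg t)).
  rewrite -catA; apply: peq_cat; first exact: peq_refl.
  apply: peq_trans (peq_comm _ _) _.
  apply: peq_cat; [exact: peq_sym | exact: peq_refl].
rewrite -{2}[fneg t]cat0s; apply: peq_cat (peq_refl _).
exact: peq_fneg.
Qed.

Definition padd (x y : presented) := pclass (repr x ++ repr y).
Definition popp (x : presented) := pclass (fneg (repr x)).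

Lemma peq_repr s : peq (repr (pclass s)) s.
Proof. by apply/pclassP; rewrite pclassK. Qed.

Lemma paddE s t : padd (pclass s) (pclass t) = pclass (s ++ t).
Proof. by apply/pclassP; apply: peq_cat; exact: peq_repr. Qed.
Lemma poppE s : popp (pclass s) = pclass (fneg s).
Proof. by apply/pclassP; apply: peq_fneg2; exact: peq_repr. Qed.

Lemma paddA : associative padd.
Proof.
by move=> x y z; rewrite -[x]pclassK -[y]pclassK -[z]pclassK !paddE catA.
Qed.
Lemma paddC : commutative padd.
Proof.
by move=> x y; rewrite -[x]pclassK -[y]pclassK !paddE; apply/pclassP/peq_comm.
Qed.
Lemma padd0 : left_id (pclass [::]) padd.
Proof. by move=> x; rewrite -[x]pclassK paddE. Qed.
Lemma paddN : left_inverse (pclass [::]) popp padd.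
Proof.
by move=> x; rewrite -[x]pclassK poppE paddE; apply/pclassP/peq_fneg.
Qed.
HB.instance Definition _ :=
  GRing.isZmodule.Build presented paddA paddC padd0 paddN.

Definition pgen (x : X) : presented := pclass [:: (true, x)].

Lemma pclassD s t : pclass (s ++ t) = pclass s + pclass t.
Proof. exact: esym (paddE s t). Qed.
Lemma pclassN s : pclass (fneg s) = - pclass s.
Proof. exact: esym (poppE s). Qed.
Lemma pclass_cons b x s :
  pclass ((b, x) :: s) = (if b then pgen x else - pgen x) + pclass s.
Proof. by rewrite -cat1s pclassD; case: b => //; rewrite -pclassN. Qed.

Lemma pgen_rel s t : E s t -> \sum_(x <- s) pgen x = \sum_(x <- t) pgen x.
Proof.
have h u : \sum_(x <- u) pgen x = pclass (fpos u).
  elim: u => [|x u IH]; first by rewrite big_nil.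
  by rewrite big_cons IH [RHS]pclass_cons.
by move=> st; rewrite !h; apply/pclassP/peq_rel.
Qed.

Lemma pind (Q : presented -> Prop) :
  (forall x, Q (pgen x)) -> Q 0 -> (forall x y, Q x -> Q y -> Q (x + y)) ->
  (forall x, Q x -> Q (- x)) -> forall x, Q x.
Proof.
move=> hg h0 hD hN x; rewrite -[x]pclassK; elim: (repr x) => [|[b y] s IH] //.
rewrite pclass_cons; apply: hD IH; case: b => //; exact: hN.
Qed.

(* The homomorphism out of the presented group sending [pgen x] to [f x]; it is
   only meaningful when [f] respects the relations, see [pliftP]. *)
Section Lift.
Context {B : zmodType} (f : X -> B).
Definition fsum (s : seq (bool * X)) : B :=
  \sum_(p <- s) (if p.1 then f p.2 else - f p.2).
Definition plift (x : presented) : B := fsum (repr x).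

Hypothesis fE : forall s t, E s t -> \sum_(x <- s) f x = \sum_(x <- t) f x.

Lemma fsum_peq s t : peq s t -> fsum s = fsum t.
Proof.
elim=> {s t} //.
- by move=> s t u _ -> _ ->.
- by move=> s s' t t' _ h _ h'; rewrite /fsum !big_cat /= -!/(fsum _) h h'.
- by move=> s t; rewrite /fsum !big_cat /= addrC.
- move=> b x; rewrite /fsum !big_cons big_nil addr0.
  by case: b => /=; rewrite ?subrr ?addNr.
- by move=> s t /fE; rewrite /fsum !big_map.
Qed.

Lemma plift_class s : plift (pclass s) = fsum s.
Proof. exact/fsum_peq/peq_repr. Qed.
Lemma plift_gen x : plift (pgen x) = f x.
Proof. by rewrite plift_class /fsum big_seq1. Qed.
Lemma pliftD x y : plift (x + y) = plift x + plift y.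
Proof.
by rewrite -[x]pclassK -[y]pclassK -pclassD !plift_class /fsum big_cat.
Qed.
Lemma pliftN x : plift (- x) = - plift x.
Proof.
rewrite -[x]pclassK -pclassN !plift_class /fsum big_map -sumrN.
by apply: eq_bigr => -[[] y] _ /=; rewrite ?opprK.
Qed.
Lemma plift0 : plift 0 = 0.
Proof. by rewrite -[0]/(pclass [::]) plift_class /fsum big_nil. Qed.
Lemma plift_sum s : plift (\sum_(x <- s) pgen x) = \sum_(x <- s) f x.
Proof.
elim: s => [|x s IH]; first by rewrite !big_nil plift0.
by rewrite !big_cons pliftD IH plift_gen.
Qed.
End Lift.
End Presented.

Record taft (K : closedFieldType) := Taft {
  tn : nat; td : nat; tq : K;
  taft_n : (1 < tn)%N;
  taft_d : (1 < td)%N;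
  taft_dvd : (td %| tn)%N;
  taft_q : td.-primitive_root tq }.

(* H_{n,d}(q) is the algebra presented by [g^n = 1], [h^d = 0], [h g = q g h], so
   a finite dimensional left module with a chosen basis is a pair of matrices,
   acting on column vectors, subject to these relations. *)
Record hmod (K : closedFieldType) (T : taft K) := HMod {
  hdim : nat;
  gact : 'M[K]_hdim;
  hact : 'M[K]_hdim;
  gactX : gact ^+ tn T = 1;
  hactX : hact ^+ td T = 0;
  hgact : hact *m gact = tq T *: (gact *m hact) }.

HB.instance Definition _ (K : closedFieldType) (T : taft K) :=
  gen_eqMixin (hmod T).
HB.instance Definition _ (K : closedFieldType) (T : taft K) :=
  gen_choiceMixin (hmod T).

Section QBinomial.
Context {K : fieldType} (q : K).

Fixpoint qbin (n k : nat) : K :=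
  match n, k with
  | _, 0 => 1
  | 0, _.+1 => 0
  | n'.+1, k'.+1 => q ^+ k * qbin n' k + qbin n' k'
  end.

Lemma qbin0 n : qbin n 0 = 1. Proof. by case: n. Qed.
Lemma qbin_small n k : (n < k)%N -> qbin n k = 0.
Proof.
elim: n k => [|n IH] [|k] //= h.
by rewrite !IH ?mulr0 ?addr0 // ltnW.
Qed.
Lemma qbinn n : qbin n n = 1.
Proof. by elim: n => [|n IH] //=; rewrite qbin_small // mulr0 add0r. Qed.

Lemma qbin_absorb n k :
  (1 - q ^+ k.+1) * qbin n.+1 k.+1 = (1 - q ^+ n.+1) * qbin n k.
Proof.
elim: n k => [|n IH] k.
  case: k => [|k] /=; first by rewrite mulr0 add0r.
  by rewrite mulr0 add0r !mulr0.
rewrite [qbin n.+2 k.+1]/= -/(qbin n.+1 k.+1) mulrDr mulrCA IH.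
have -> : q ^+ k.+1 * ((1 - q ^+ n.+1) * qbin n k) =
          (q ^+ k.+1 - q ^+ n.+2) * qbin n.+1 k.
  case: k => [|k].
    by rewrite !qbin0 !mulr1 mulrBr mulr1 -!exprD.
  have := IH k; set b := qbin n.+1 k.+1 => h.
  have bE : b = q ^+ k.+1 * qbin n k.+1 + qbin n k by [].
  rewrite (exprS q k.+1) (exprS q n.+1) -mulrA -mulrBr -mulrA; congr (q * _).
  have -> : q ^+ k.+1 - q ^+ n.+1 = (1 - q ^+ n.+1) - (1 - q ^+ k.+1).
    by rewrite opprB [RHS]addrC addrA subrK.
  by rewrite [RHS]mulrBl h -mulrBr bE addrK mulrCA.
by rewrite -mulrDl addrC subrKA.
Qed.

Lemma qbin_root d k : d.-primitive_root q -> (0 < k < d)%N -> qbin d k = 0.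
Proof.
move=> hq; case: d k hq => [|d] [|k] hq // /= hk.
have /eqP := qbin_absorb d k; rewrite (prim_expr_order hq) subrr mul0r mulf_eq0.
case/orP=> /eqP // /eqP; rewrite subr_eq0 eq_sym -(prim_order_dvd hq).
by move/dvdn_leq => /(_ isT); rewrite leqNgt hk.
Qed.

Lemma sqmxZl N a (x y : 'M[K]_N) : (a *: x) * y = a *: (x * y).
Proof. exact: esym (scalemxAl a x y). Qed.
Lemma sqmxZr N a (x y : 'M[K]_N) : x * (a *: y) = a *: (x * y).
Proof. exact: esym (scalemxAr a x y). Qed.

Lemma qcommX N (x y : 'M[K]_N) k :
  x * y = q *: (y * x) -> x * y ^+ k = q ^+ k *: (y ^+ k * x).
Proof.
move=> xy; elim: k => [|k IH]; first by rewrite !expr0 mulr1 mul1r scale1r.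
rewrite exprS mulrA xy sqmxZl -[y * x * _]mulrA IH.
by rewrite sqmxZr scalerA -exprS mulrA -exprS.
Qed.

Lemma qbinomial N (x y : 'M[K]_N) n : x * y = q *: (y * x) ->
  (x + y) ^+ n = \sum_(k < n.+1) qbin n k *: (y ^+ k * x ^+ (n - k)).
Proof.
move=> xy; elim: n => [|n IH].
  by rewrite big_ord1 !expr0 mulr1 scale1r.
rewrite exprS IH mulrDl !mulr_sumr.
rewrite [in RHS]big_ord_recl /= expr0 subn0 mul1r scale1r.
under [in RHS]eq_bigr => k _ do rewrite scalerDl.
rewrite big_split /= addrA; congr (_ + _); last first.
  apply: eq_bigr => k _.
  by rewrite /bump /= add1n subSS exprS -mulrA sqmxZr.
rewrite big_ord_recl /= expr0 mul1r subn0 qbin0 scale1r -exprS; congr (_ + _).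
rewrite [in RHS]big_ord_recr /= /bump /= add1n qbin_small // mulr0 scale0r addr0.
apply: eq_bigr => k _; rewrite /bump /= add1n.
rewrite sqmxZr mulrA (qcommX _ xy) sqmxZl scalerA mulrC.
by rewrite -mulrA -exprS subSS subnSK.
Qed.

Lemma qbinomial_root N (x y : 'M[K]_N) d : d.-primitive_root q ->
  x * y = q *: (y * x) -> x ^+ d = 0 -> y ^+ d = 0 -> (x + y) ^+ d = 0.
Proof.
move=> hq xy xd yd; rewrite (qbinomial _ xy) big1 // => -[k hk] _ /=.
have [->|k0] := posnP k; first by rewrite subn0 xd mulr0 scaler0.
have [->|kd] := eqVneq k d; first by rewrite yd mul0r scaler0.
rewrite (qbin_root hq) ?scale0r // k0 /= ltn_neqAle kd; exact: hk.
Qed.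
End QBinomial.

Section TaftModules.
Context {K : closedFieldType} {T : taft K}.
Local Notation n := (tn T).
Local Notation d := (td T).
Local Notation q := (tq T).
Implicit Types V W : hmod T.

Definition is_hom V W (f : 'M[K]_(hdim W, hdim V)) :=
  f *m gact V = gact W *m f /\ f *m hact V = hact W *m f.

Definition hiso V W :=
  exists (f : 'M[K]_(hdim W, hdim V)) (f' : 'M[K]_(hdim V, hdim W)),
    [/\ is_hom f, f *m f' = 1%:M & f' *m f = 1%:M].

Definition is_hsub V (U : {vspace 'cV[K]_(hdim V)}) :=
  forall u, u \in U -> gact V *m u \in U /\ hact V *m u \in U.

Definition semisimple V :=
  forall U : {vspace 'cV[K]_(hdim V)}, is_hsub U ->
    exists2 U' : {vspace 'cV[K]_(hdim V)}, is_hsub U' &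
      (U + U')%VS = fullv /\ (U :&: U')%VS = 0%VS.

(* Projectivity in the category of finite dimensional modules. *)
Definition projective V :=
  forall A B (p : 'M[K]_(hdim B, hdim A)) (f : 'M[K]_(hdim B, hdim V)),
    is_hom p -> \rank p = hdim B -> is_hom f ->
    exists2 f' : 'M[K]_(hdim A, hdim V), is_hom f' & p *m f' = f.

Lemma block_diagX a b (A : 'M[K]_a) (B : 'M[K]_b) k :
  block_mx A 0 0 B ^+ k = block_mx (A ^+ k) 0 0 (B ^+ k).
Proof.
elim: k => [|k IH]; first by rewrite !expr0 -scalar_mx_block.
rewrite !exprS IH -[block_mx A _ _ _ * _]/(_ *m _) mulmx_block.
by rewrite !mulmx0 !mul0mx !addr0 !add0r.
Qed.

Lemma tensmx11 a b : (1%:M : 'M[K]_a) *t (1%:M : 'M[K]_b) = 1%:M.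
Proof.
apply/matrixP => i j; case: (mxtens_indexP i) => i1 i2.
case: (mxtens_indexP j) => j1 j2; rewrite tensmxE !mxE -natrM mulnb.
by rewrite (can_eq (@mxtens_indexK _ _)) xpair_eqE.
Qed.

Lemma tensmxX a b (A : 'M[K]_a) (B : 'M[K]_b) k :
  (A *t B) ^+ k = (A ^+ k) *t (B ^+ k).
Proof.
elim: k => [|k IH]; first by rewrite !expr0 -[RHS]/(1%:M *t 1%:M) tensmx11.
by rewrite !exprS IH -[LHS]/(_ *m _) tensmx_mul.
Qed.

Lemma tensZl a b c e (x : K) (A : 'M[K]_(a, b)) (B : 'M[K]_(c, e)) :
  (x *: A) *t B = x *: (A *t B).
Proof. by apply/matrixP => i j; rewrite !mxE mulrA. Qed.
Lemma tensZr a b c e (x : K) (A : 'M[K]_(a, b)) (B : 'M[K]_(c, e)) :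
  A *t (x *: B) = x *: (A *t B).
Proof. by apply/matrixP => i j; rewrite !mxE mulrCA. Qed.

Lemma td_gt0 : (0 < d)%N. Proof. exact: ltnW (taft_d T). Qed.

Lemma hsum_gX V W : block_mx (gact V) 0 0 (gact W) ^+ n = 1.
Proof. by rewrite block_diagX !gactX -scalar_mx_block. Qed.
Lemma hsum_hX V W : block_mx (hact V) 0 0 (hact W) ^+ d = 0.
Proof. by rewrite block_diagX !hactX block_mx0. Qed.
Lemma hsum_hg V W :
  block_mx (hact V) 0 0 (hact W) *m block_mx (gact V) 0 0 (gact W) =
  q *: (block_mx (gact V) 0 0 (gact W) *m block_mx (hact V) 0 0 (hact W)).
Proof.
rewrite !mulmx_block !mulmx0 !mul0mx !addr0 !add0r.
by rewrite !hgact scale_block_mx !scaler0.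
Qed.
Definition hsum V W : hmod T := HMod (hsum_gX V W) (hsum_hX V W) (hsum_hg V W).

(* The comultiplication is [g |-> g (x) g], [h |-> 1 (x) h + h (x) g]. *)
Definition htens_g V W := gact V *t gact W.
Definition htens_h V W := (1%:M *t hact W + hact V *t gact W).
Lemma htens_gX V W : htens_g V W ^+ n = 1.
Proof. by rewrite tensmxX !gactX -[LHS]/(1%:M *t 1%:M) tensmx11. Qed.
Lemma htens_hX V W : htens_h V W ^+ d = 0.
Proof.
apply: (qbinomial_root (taft_q T)).
- rewrite -![_ * _]/(_ *m _) !tensmx_mul mulmx1 mul1mx hgact; exact: tensZr.
- by rewrite tensmxX hactX tensmx0.
- by rewrite tensmxX hactX tens0mx.
Qed.
Lemma htens_hg V W :
  htens_h V W *m htens_g V W = q *: (htens_g V W *m htens_h V W).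
Proof.
rewrite mulmxDl mulmxDr scalerDr !tensmx_mul mul1mx mulmx1 !hgact.
by rewrite tensZl tensZr.
Qed.
Definition htens V W : hmod T :=
  HMod (htens_gX V W) (htens_hX V W) (htens_hg V W).

Lemma hunit_hX : (0 : 'M[K]_1) ^+ d = 0.
Proof. by rewrite expr0n eqn0Ngt td_gt0. Qed.
Lemma hunit_hg : (0 : 'M[K]_1) *m 1 = q *: (1 *m (0 : 'M[K]_1)).
Proof. by rewrite mul0mx mulmx0 scaler0. Qed.
Definition hunit : hmod T := HMod (expr1n _ n) hunit_hX hunit_hg.

Lemma hiso_reindex V W (phi : 'I_(hdim V) -> 'I_(hdim W)) : bijective phi ->
  (forall i j, gact V i j = gact W (phi i) (phi j)) ->
  (forall i j, hact V i j = hact W (phi i) (phi j)) -> hiso V W.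
Proof.
move=> [psi pK qK] gE hE.
pose f : 'M[K]_(hdim W, hdim V) := \matrix_(a, i) (a == phi i)%:R.
pose f' : 'M[K]_(hdim V, hdim W) := \matrix_(i, a) (a == phi i)%:R.
have fl m (A : 'M[K]_(hdim V, m)) a j : (f *m A) a j = A (psi a) j.
  rewrite mxE (bigD1 (psi a)) //= mxE qK eqxx mul1r big1 ?addr0 // => i ia.
  by rewrite mxE -[a in a == _]qK (can_eq pK) eq_sym (negPf ia) mul0r.
have fr m (A : 'M[K]_(m, hdim W)) a j : (A *m f) a j = A a (phi j).
  rewrite mxE (bigD1 (phi j)) //= mxE eqxx mulr1 big1 ?addr0 // => i ia.
  by rewrite mxE (negPf ia) mulr0.
exists f, f'; split.
- split; apply/matrixP => a j; rewrite fl fr ?gE ?hE qK //.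
- apply/matrixP => a b; rewrite fl !mxE qK eq_sym; by [].
- by apply/matrixP => a b; rewrite fr !mxE (can_eq pK) eq_sym.
Qed.

Lemma hiso_tens V V' W W' :
  hiso V V' -> hiso W W' -> hiso (htens V W) (htens V' W').
Proof.
move=> [f [f' [[fg fh] ff' f'f]]] [e [e' [[eg eh] ee' e'e]]].
exists (f *t e), (f' *t e'); split.
- split; first by rewrite !tensmx_mul fg eg.
  by rewrite mulmxDr mulmxDl !tensmx_mul mulmx1 mul1mx fh eg eh.
- by rewrite tensmx_mul ff' ee' tensmx11.
- by rewrite tensmx_mul f'f e'e tensmx11.
Qed.

Lemma hiso_refl V : hiso V V.
Proof.
by exists 1%:M, 1%:M; split; rewrite ?mulmx1 //; split; rewrite mulmx1 mul1mx.
Qed.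

(* Index bijections realizing the distributivity and associativity
   isomorphisms. *)
Definition distl a b c (k : 'I_((a + b) * c)) : 'I_(a * c + b * c) :=
  let p := mxtens_unindex k in
  match split p.1 with
  | inl i => lshift _ (mxtens_index (i, p.2))
  | inr i => rshift _ (mxtens_index (i, p.2))
  end.
Definition distl' a b c (k : 'I_(a * c + b * c)) : 'I_((a + b) * c) :=
  match split k with
  | inl u => let p := mxtens_unindex u in mxtens_index (lshift _ p.1, p.2)
  | inr u => let p := mxtens_unindex u in mxtens_index (rshift _ p.1, p.2)
  end.
Definition distr a b c (k : 'I_(c * (a + b))) : 'I_(c * a + c * b) :=
  let p := mxtens_unindex k in
  match split p.2 with
  | inl i => lshift _ (mxtens_index (p.1, i))
  | inr i => rshift _ (mxtens_index (p.1, i))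
  end.
Definition distr' a b c (k : 'I_(c * a + c * b)) : 'I_(c * (a + b)) :=
  match split k with
  | inl u => let p := mxtens_unindex u in mxtens_index (p.1, lshift _ p.2)
  | inr u => let p := mxtens_unindex u in mxtens_index (p.1, rshift _ p.2)
  end.
Definition tassoc a b c (k : 'I_(a * (b * c))) : 'I_((a * b) * c) :=
  let p := mxtens_unindex k in let r := mxtens_unindex p.2 in
  mxtens_index (mxtens_index (p.1, r.1), r.2).
Definition tassoc' a b c (k : 'I_((a * b) * c)) : 'I_(a * (b * c)) :=
  let p := mxtens_unindex k in let r := mxtens_unindex p.1 in
  mxtens_index (r.1, mxtens_index (r.2, p.2)).

Lemma unindex1 a b (i : 'I_a) (j : 'I_b) :
  Ordinal (mxtens_index_proof1 (mxtens_index (i, j))) = i.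
Proof. exact: (congr1 fst (@mxtens_indexK _ _ (i, j))). Qed.
Lemma unindex2 a b (i : 'I_a) (j : 'I_b) :
  Ordinal (mxtens_index_proof2 (mxtens_index (i, j))) = j.
Proof. exact: (congr1 snd (@mxtens_indexK _ _ (i, j))). Qed.
Let tindexK := (unindex1, unindex2, mxtens_indexK).

Lemma split_l a b (i : 'I_a) : split (lshift b i) = inl i.
Proof. exact: (unsplitK (inl i)). Qed.
Lemma split_r a b (i : 'I_b) : split (rshift a i) = inr i.
Proof. exact: (unsplitK (inr i)). Qed.

Lemma distl_bij a b c : bijective (@distl a b c).
Proof.
exists (@distl' a b c) => k.
  case: (mxtens_indexP k) => p s; rewrite /distl mxtens_indexK /= -{2}(splitK p).
  by case: (split p) => u /=; rewrite /distl' ?split_l ?split_r mxtens_indexK.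
rewrite /distl' -{2}(splitK k); case: (split k) => u /=;
  case: (mxtens_indexP u) => p s; rewrite !tindexK /distl mxtens_indexK /=;
  by rewrite ?split_l ?split_r.
Qed.
Lemma distr_bij a b c : bijective (@distr a b c).
Proof.
exists (@distr' a b c) => k.
  case: (mxtens_indexP k) => p s; rewrite /distr mxtens_indexK /= -{2}(splitK s).
  by case: (split s) => u /=; rewrite /distr' ?split_l ?split_r mxtens_indexK.
rewrite /distr' -{2}(splitK k); case: (split k) => u /=;
  case: (mxtens_indexP u) => p s; rewrite !tindexK /distr mxtens_indexK /=;
  by rewrite ?split_l ?split_r.
Qed.
Lemma tassoc_bij a b c : bijective (@tassoc a b c).
Proof.
exists (@tassoc' a b c) => k; case: (mxtens_indexP k) => p s.
  case: (mxtens_indexP s) => r t.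
  by rewrite /tassoc /tassoc'; lazy zeta; rewrite !mxtens_indexK.
case: (mxtens_indexP p) => r t.
by rewrite /tassoc /tassoc'; lazy zeta; rewrite !mxtens_indexK.
Qed.

Lemma tensE a b (A : 'M[K]_a) (B : 'M[K]_b) p r :
  (A *t B) p r = A (mxtens_unindex p).1 (mxtens_unindex r).1 *
                 B (mxtens_unindex p).2 (mxtens_unindex r).2.
Proof. by rewrite mxE. Qed.

Lemma distlE a b c (A : 'M[K]_a) (B : 'M[K]_b) (C : 'M[K]_c) i j :
  (block_mx A 0 0 B *t C) i j =
  block_mx (A *t C) 0 0 (B *t C) (distl i) (distl j).
Proof.
rewrite tensE /distl; case: (mxtens_unindex i) => p r.
case: (mxtens_unindex j) => s t /=.
rewrite -{1}(splitK p) -{1}(splitK s).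
case: (split p) => u; case: (split s) => v /=;
  rewrite ?block_mxEul ?block_mxEur ?block_mxEdl ?block_mxEdr ?tensmxE //;
  by rewrite ?[(0 : 'M__) _ _]mxE ?mxE ?mul0r.
Qed.
Lemma distrE a b c (A : 'M[K]_a) (B : 'M[K]_b) (C : 'M[K]_c) i j :
  (C *t block_mx A 0 0 B) i j =
  block_mx (C *t A) 0 0 (C *t B) (distr i) (distr j).
Proof.
rewrite tensE /distr; case: (mxtens_unindex i) => p r.
case: (mxtens_unindex j) => s t /=.
rewrite -{1}(splitK r) -{1}(splitK t).
case: (split r) => u; case: (split t) => v /=;
  rewrite ?block_mxEul ?block_mxEur ?block_mxEdl ?block_mxEdr ?tensmxE //;
  by rewrite ?[(0 : 'M__) _ _]mxE ?mxE ?mulr0.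
Qed.
Lemma tassocE a b c (A : 'M[K]_a) (B : 'M[K]_b) (C : 'M[K]_c) i j :
  (A *t (B *t C)) i j = ((A *t B) *t C) (tassoc i) (tassoc j).
Proof. by rewrite !tensE /tassoc !mxtens_indexK /= mulrA. Qed.

Lemma scalar_block a b : (1%:M : 'M[K]_(a + b)) = block_mx 1%:M 0 0 1%:M.
Proof. exact: scalar_mx_block. Qed.

Lemma block_diagD a b (A A' : 'M[K]_a) (B B' : 'M[K]_b) :
  block_mx (A + A') 0 0 (B + B') = block_mx A 0 0 B + block_mx A' 0 0 B'.
Proof. by rewrite add_block_mx !addr0. Qed.

Lemma hiso_distl V V' W :
  hiso (htens (hsum V V') W) (hsum (htens V W) (htens V' W)).
Proof.
apply: (@hiso_reindex (htens (hsum V V') W) (hsum (htens V W) (htens V' W))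
  _ (distl_bij _ _ _)) => i j /=; first exact: distlE.
by rewrite /htens_h /= scalar_block block_diagD mxE [RHS]mxE !distlE.
Qed.
Lemma hiso_distr V V' W :
  hiso (htens W (hsum V V')) (hsum (htens W V) (htens W V')).
Proof.
apply: (@hiso_reindex (htens W (hsum V V')) (hsum (htens W V) (htens W V'))
  _ (distr_bij _ _ _)) => i j /=; first exact: distrE.
by rewrite /htens_h /= block_diagD mxE [RHS]mxE !distrE.
Qed.
Lemma tensDl a b c e (A B : 'M[K]_(a, b)) (C : 'M[K]_(c, e)) :
  (A + B) *t C = A *t C + B *t C.
Proof. by apply/matrixP => i j; rewrite !mxE mulrDl. Qed.
Lemma tensDr a b c e (A B : 'M[K]_(a, b)) (C : 'M[K]_(c, e)) :
  C *t (A + B) = C *t A + C *t B.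
Proof. by apply/matrixP => i j; rewrite !mxE mulrDr. Qed.

Lemma hiso_assoc U V W : hiso (htens U (htens V W)) (htens (htens U V) W).
Proof.
apply: (@hiso_reindex (htens U (htens V W)) (htens (htens U V) W)
  _ (tassoc_bij _ _ _)) => i j /=; first exact: tassocE.
rewrite /htens_h /= /htens_h /htens_g tensDl tensDr -tensmx11 addrA.
by rewrite mxE [in LHS]mxE [RHS]mxE [in RHS]mxE !tassocE.
Qed.

Lemma hiso_unitl V : hiso (htens hunit V) V.
Proof.
apply: (@hiso_reindex (htens hunit V) V (fun k => (mxtens_unindex k).2)).
- exists (fun i => mxtens_index (ord0, i)) => k; last by rewrite mxtens_indexK.
  by case: (mxtens_indexP k) => i j; rewrite mxtens_indexK (ord1 i).
- by move=> i j; rewrite /= tensE !ord1 mxE mul1r.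
- by move=> i j; rewrite /= /htens_h tens0mx addr0 tensE !ord1 mxE mul1r.
Qed.
Lemma hiso_unitr V : hiso (htens V hunit) V.
Proof.
apply: (@hiso_reindex (htens V hunit) V (fun k => (mxtens_unindex k).1)).
- exists (fun i => mxtens_index (i, ord0)) => k; last by rewrite mxtens_indexK.
  by case: (mxtens_indexP k) => i j; rewrite mxtens_indexK (ord1 j).
- by move=> i j; rewrite /= tensE (ord1 (_ i).2) (ord1 (_ j).2) mxE mulr1.
- move=> i j; rewrite /= /htens_h tensmx0 add0r tensE.
  by rewrite (ord1 (_ i).2) (ord1 (_ j).2) mxE mulr1.
Qed.

(* [indec l i] is [M(l, i)]: [g v_j = w^i q^-j v_j] and [h v_j = v_{j+1}], with
   [v_l = 0]. *)
Section Indecomposable.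
Context (w : K) (hw : n.-primitive_root w) (hwq : w ^+ (n %/ d) = q).
Context (l : nat) (hl : (0 < l <= d)%N) (i : 'Z_n).

Definition indec_g : 'M[K]_l := diag_mx (\row_j (w ^+ i * q ^- j)).
Definition indec_h : 'M[K]_l := \matrix_(a, b) (a == b.+1 :> nat)%:R.

Lemma indec_gX : indec_g ^+ n = 1.
Proof.
have h k : indec_g ^+ k = diag_mx (\row_j (w ^+ i * q ^- j) ^+ k).
  elim: k => [|k IH].
    by rewrite expr0; apply/matrixP => a b; rewrite !mxE.
  rewrite exprS IH -[LHS]/(_ *m _) mulmx_diag; congr diag_mx.
  by apply/rowP => j; rewrite !mxE exprS.
have wX k : (w ^+ k) ^+ n = 1 by rewrite exprAC (prim_expr_order hw) expr1n.
rewrite h; apply/matrixP => a b; rewrite !mxE exprMn exprVn wX.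
by rewrite -hwq -exprM wX invr1 mulr1.
Qed.

Lemma indec_hX : indec_h ^+ d = 0.
Proof.
have h k : indec_h ^+ k = \matrix_(a, b) (a == (b + k)%N :> nat)%:R.
  elim: k => [|k IH].
    by apply/matrixP => a b; rewrite !mxE addn0.
  rewrite exprSr IH -[LHS]/(_ *m _); apply/matrixP => a b; rewrite !mxE.
  have [bl|bl] := ltnP b.+1 l.
    rewrite (bigD1 (Ordinal bl)) //= !mxE eqxx mulr1 big1 ?addr0 ?addSnnS //.
    move=> c cb; rewrite !mxE; have [e|_] := eqVneq (c : nat) b.+1; last by rewrite mulr0.
    by rewrite -val_eqE /= e eqxx in cb.
  rewrite big1 => [|c _]; last first.
    rewrite !mxE [(c : nat) == b.+1]ltn_eqF ?mulr0 //.
    exact: leq_trans (ltn_ord c) bl.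
  by rewrite ltn_eqF // (leq_trans (ltn_ord a)) // (leq_trans bl) // -addSnnS leq_addr.
rewrite h; apply/matrixP => a b; rewrite !mxE ltn_eqF //.
case/andP: hl => _ hd; apply: leq_trans (ltn_ord a) _.
exact: leq_trans hd (leq_addl _ _).
Qed.

Lemma indec_hg : indec_h *m indec_g = q *: (indec_g *m indec_h).
Proof.
apply/matrixP => a b; rewrite mul_mx_diag mxE mul_diag_mx !mxE.
case: eqP => [->|_]; last by rewrite mul0r !mulr0.
have q0 : q != 0 by rewrite (prim_root_eq0 (taft_q T)) -lt0n td_gt0.
by rewrite mul1r mulr1 [RHS]mulrCA exprS invfM mulVKf.
Qed.

Definition indec : hmod T := HMod indec_gX indec_hX indec_hg.
End Indecomposable.
End TaftModules.

Section Green.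
Context {K : closedFieldType} (T : taft K).

Inductive green_rel : seq (hmod T) -> seq (hmod T) -> Prop :=
| green_iso V W : hiso V W -> green_rel [:: V] [:: W]
| green_sum V W : green_rel [:: hsum V W] [:: V; W].

Definition green := presented green_rel.
HB.instance Definition _ := GRing.Zmodule.on green.

Definition gcls (V : hmod T) : green := pgen green_rel V.

Lemma gcls_iso V W : hiso V W -> gcls V = gcls W.
Proof. by move/green_iso/pgen_rel; rewrite !big_seq1. Qed.
Lemma gcls_sum V W : gcls (hsum V W) = gcls V + gcls W.
Proof.
by have := pgen_rel (green_sum V W); rewrite big_seq1 big_cons big_seq1.
Qed.

Lemma gind (Q : green -> Prop) :
  (forall V, Q (gcls V)) -> Q 0 -> (forall x y, Q x -> Q y -> Q (x + y)) ->
  (forall x, Q x -> Q (- x)) -> forall x, Q x.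
Proof. exact: pind. Qed.

Section GreenLift.
Context {B : zmodType} (f : hmod T -> B).
Hypothesis f_iso : forall V W, hiso V W -> f V = f W.
Hypothesis f_sum : forall V W, f (hsum V W) = f V + f W.
Lemma green_resp s t : green_rel s t -> \sum_(V <- s) f V = \sum_(V <- t) f V.
Proof.
case=> [V W /f_iso h|V W]; rewrite ?big_cons ?big_nil ?addr0 //.
Qed.
End GreenLift.

Definition gmulm (V : hmod T) : green -> green :=
  plift (fun W => gcls (htens V W)).

(* [[V] * [W] = [V (x) W]], extended biadditively; see [gclsM]. *)
Definition gmul (x y : green) : green := plift (fun V => gmulm V y) x.

Lemma gmulm_resp V s t : green_rel s t ->
  \sum_(W <- s) gcls (htens V W) = \sum_(W <- t) gcls (htens V W).
Proof.
apply: green_resp => [W W' h|W W'].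
  by apply: gcls_iso; apply: hiso_tens h; exact: hiso_refl.
by rewrite -gcls_sum; apply/gcls_iso/hiso_distr.
Qed.
Lemma gmulm_cls V W : gmulm V (gcls W) = gcls (htens V W).
Proof. exact: plift_gen (gmulm_resp V) W. Qed.
Lemma gmulmD V x y : gmulm V (x + y) = gmulm V x + gmulm V y.
Proof. exact: pliftD (gmulm_resp V) x y. Qed.
Lemma gmulm0 V : gmulm V 0 = 0.
Proof. exact: plift0 (gmulm_resp V). Qed.
Lemma gmulmN V x : gmulm V (- x) = - gmulm V x.
Proof. exact: pliftN (gmulm_resp V) x. Qed.

Lemma gmul_resp y s t : green_rel s t ->
  \sum_(V <- s) gmulm V y = \sum_(V <- t) gmulm V y.
Proof.
apply: green_resp => [V W h|V W]; elim/gind: y => [U||x y hx hy|x hx].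
- by rewrite !gmulm_cls; apply: gcls_iso; apply: hiso_tens => //; exact: hiso_refl.
- by rewrite !gmulm0.
- by rewrite !gmulmD hx hy.
- by rewrite !gmulmN hx.
- by rewrite !gmulm_cls -gcls_sum; apply/gcls_iso/hiso_distl.
- by rewrite !gmulm0 addr0.
- by rewrite !gmulmD hx hy addrACA.
- by rewrite !gmulmN hx opprD.
Qed.

Lemma gclsM V W : gmul (gcls V) (gcls W) = gcls (htens V W).
Proof. by rewrite /gmul (plift_gen (gmul_resp _)) gmulm_cls. Qed.

Lemma gmulDl : left_distributive gmul +%R.
Proof. by move=> x y z; exact: pliftD (gmul_resp z) x y. Qed.
Lemma gmulDr : right_distributive gmul +%R.
Proof.
move=> x y z; elim/gind: x => [V||u v hu hv|u hu]; rewrite /gmul.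
- by rewrite !(plift_gen (gmul_resp _)) gmulmD.
- by rewrite !(plift0 (gmul_resp _)) addr0.
- by rewrite !(pliftD (gmul_resp _)) -!/(gmul _ _) hu hv addrACA.
- by rewrite !(pliftN (gmul_resp _)) -!/(gmul _ _) hu opprD.
Qed.
Lemma gmul0l x : gmul 0 x = 0. Proof. exact: plift0 (gmul_resp x). Qed.
Lemma gmulNl x y : gmul (- x) y = - gmul x y.
Proof. exact: pliftN (gmul_resp y) x. Qed.
Lemma gmul0r x : gmul x 0 = 0.
Proof. by apply: (addIr (gmul x 0)); rewrite -gmulDr !add0r. Qed.
Lemma gmulNr x y : gmul x (- y) = - gmul x y.
Proof. by apply: (addrI (gmul x y)); rewrite -gmulDr !subrr gmul0r. Qed.

Lemma gmulA : associative gmul.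
Proof.
move=> x y z; elim/gind: x => [U||u v hu hv|u hu].
- elim/gind: y => [V||u v hu hv|u hu].
  + elim/gind: z => [W||u v hu hv|u hu].
    * by rewrite !gclsM; apply/gcls_iso/hiso_assoc.
    * by rewrite !gmul0r.
    * by rewrite !gmulDr hu hv.
    * by rewrite !gmulNr hu.
  + by rewrite !(gmul0l, gmul0r).
  + by rewrite !(gmulDl, gmulDr) hu hv.
  + by rewrite !(gmulNl, gmulNr) hu.
- by rewrite !gmul0l.
- by rewrite !gmulDl hu hv.
- by rewrite !gmulNl hu.
Qed.
Lemma gmul1l : left_id (gcls hunit) gmul.
Proof.
move=> x; elim/gind: x => [V||x y hx hy|x hx].
- by rewrite gclsM; apply/gcls_iso/hiso_unitl.
- by rewrite gmul0r.
- by rewrite gmulDr hx hy.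
- by rewrite gmulNr hx.
Qed.
Lemma gmul1r : right_id (gcls hunit) gmul.
Proof.
move=> x; elim/gind: x => [V||x y hx hy|x hx].
- by rewrite gclsM; apply/gcls_iso/hiso_unitr.
- by rewrite gmul0l.
- by rewrite gmulDl hx hy.
- by rewrite gmulNl hx.
Qed.

Definition gdim : green -> int := plift (fun V => (hdim V)%:Z).
Lemma hiso_dim V W : @hiso K T V W -> hdim V = hdim W.
Proof.
move=> [f [f' [_ h h']]]; apply/eqP; rewrite eqn_leq; apply/andP; split.
  by have := mulmx_max_rank f' f; rewrite h' mxrank1.
by have := mulmx_max_rank f f'; rewrite h mxrank1.
Qed.
Lemma gdim_resp s t : green_rel s t ->
  \sum_(V <- s) (hdim V)%:Z = \sum_(V <- t) (hdim V)%:Z.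
Proof. by apply: green_resp => [V W /hiso_dim ->|]. Qed.

Lemma green1_neq0 : gcls hunit != 0.
Proof.
apply/eqP => /(congr1 gdim).
by rewrite /gdim (plift0 gdim_resp) (plift_gen gdim_resp).
Qed.

HB.instance Definition _ := GRing.Zmodule_isNzRing.Build green
  gmulA gmul1l gmul1r gmulDl gmulDr green1_neq0.

(* The projective class ring: the smallest subring of the Green ring containing
   the classes of the projective and of the semisimple modules. *)
Definition pcr_pred : {pred green} := fun x =>
  `[< forall S : {pred green}, GRing.subring_closed S ->
      (forall V, projective V \/ semisimple V -> gcls V \in S) -> x \in S >].

Lemma pcr_subring : GRing.subring_closed pcr_pred.
Proof.
split=> [|x y /asboolP hx /asboolP hy|x y /asboolP hx /asboolP hy];
  apply/asboolP => S hS hc; case: (hS) => h1 hB hM; first exact: h1.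
  by apply: hB; [exact: hx | exact: hy].
by apply: hM; [exact: hx | exact: hy].
Qed.
HB.instance Definition _ := GRing.isSubringClosed.Build green pcr_pred pcr_subring.

Definition pcr := {x : green | x \in pcr_pred}.
HB.instance Definition _ := SubChoice.on pcr.
HB.instance Definition _ := [SubChoice_isSubNzRing of pcr by <:].

Lemma pcr_mem V : projective V \/ semisimple V -> gcls V \in pcr_pred.
Proof. by move=> h; apply/asboolP => S _; apply. Qed.
Definition pcls V (hV : projective V \/ semisimple V) : pcr :=
  exist _ (gcls V) (pcr_mem hV).
End Green.

(* [PH F T] is [F (x)_Z p(H_{n,d}(q))], presented by the pure tensors
   [ptens c a] and the biadditivity relations. *)
Section ScalarExtension.
Context (F : fieldType) {K : closedFieldType} (T : taft K).

Inductive tens_rel : seq (F * pcr T) -> seq (F * pcr T) -> Prop :=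
| tens_addl c c' a : tens_rel [:: (c + c', a)] [:: (c, a); (c', a)]
| tens_addr c a a' : tens_rel [:: (c, a + a')] [:: (c, a); (c, a')].

Definition PH := presented tens_rel.
HB.instance Definition _ := GRing.Zmodule.on PH.

Definition ptens (c : F) (a : pcr T) : PH := pgen tens_rel (c, a).

Lemma ptensDl c c' a : ptens (c + c') a = ptens c a + ptens c' a.
Proof.
by have := pgen_rel (tens_addl c c' a); rewrite big_seq1 big_cons big_seq1.
Qed.
Lemma ptensDr c a a' : ptens c (a + a') = ptens c a + ptens c a'.
Proof.
by have := pgen_rel (tens_addr c a a'); rewrite big_seq1 big_cons big_seq1.
Qed.

Lemma PHind (Q : PH -> Prop) :
  (forall c a, Q (ptens c a)) -> Q 0 -> (forall x y, Q x -> Q y -> Q (x + y)) ->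
  (forall x, Q x -> Q (- x)) -> forall x, Q x.
Proof. by move=> h h0 hD hN; apply: pind => // -[c a]; exact: h. Qed.

Lemma PHresp (B : zmodType) (f : F * pcr T -> B) :
  (forall c c' a, f (c + c', a) = f (c, a) + f (c', a)) ->
  (forall c a a', f (c, a + a') = f (c, a) + f (c, a')) ->
  forall s t, tens_rel s t -> \sum_(p <- s) f p = \sum_(p <- t) f p.
Proof.
by move=> hl hr s t; case=> *; rewrite !big_cons !big_nil !addr0 ?hl ?hr.
Qed.

Definition pmulm (p : F * pcr T) : PH -> PH :=
  plift (fun r => ptens (p.1 * r.1) (p.2 * r.2)).

(* [(c (x) a) * (c' (x) a') = (c * c') (x) (a * a')]; see [ptensM]. *)
Definition pmul (x y : PH) : PH := plift (fun p => pmulm p y) x.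

(* [c *: (c' (x) a) = (c * c') (x) a]; see [ptensZ]. *)
Definition pscale (c : F) (x : PH) : PH :=
  plift (fun r => ptens (c * r.1) r.2) x.

Lemma pmulm_resp p s t : tens_rel s t ->
  \sum_(r <- s) ptens (p.1 * r.1) (p.2 * r.2) =
  \sum_(r <- t) ptens (p.1 * r.1) (p.2 * r.2).
Proof.
apply: (PHresp (f := fun r => ptens (p.1 * r.1) (p.2 * r.2))) => c c' a /=.
  by rewrite mulrDr ptensDl.
by rewrite mulrDr ptensDr.
Qed.
Lemma pmulmD p x y : pmulm p (x + y) = pmulm p x + pmulm p y.
Proof. exact: pliftD (pmulm_resp p) x y. Qed.
Lemma pmulm0 p : pmulm p 0 = 0.
Proof. exact: plift0 (pmulm_resp p). Qed.
Lemma pmulmN p x : pmulm p (- x) = - pmulm p x.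
Proof. exact: pliftN (pmulm_resp p) x. Qed.
Lemma pmulm_tens p c a : pmulm p (ptens c a) = ptens (p.1 * c) (p.2 * a).
Proof. exact: plift_gen (pmulm_resp p) (c, a). Qed.

Lemma pmul_resp y s t : tens_rel s t ->
  \sum_(p <- s) pmulm p y = \sum_(p <- t) pmulm p y.
Proof.
apply: (PHresp (f := fun p => pmulm p y)) => u v w;
  elim/PHind: y => [c a||x y hx hy|x hx].
- by rewrite !pmulm_tens /= mulrDl ptensDl.
- by rewrite !pmulm0 addr0.
- by rewrite !pmulmD hx hy addrACA.
- by rewrite !pmulmN hx opprD.
- by rewrite !pmulm_tens /= mulrDl ptensDr.
- by rewrite !pmulm0 addr0.
- by rewrite !pmulmD hx hy addrACA.
- by rewrite !pmulmN hx opprD.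
Qed.
Lemma ptensM c a c' a' :
  pmul (ptens c a) (ptens c' a') = ptens (c * c') (a * a').
Proof. by rewrite /pmul (plift_gen (pmul_resp _)) pmulm_tens. Qed.
Lemma pmulDl : left_distributive pmul +%R.
Proof. by move=> x y z; exact: pliftD (pmul_resp z) x y. Qed.
Lemma pmul0l x : pmul 0 x = 0. Proof. exact: plift0 (pmul_resp x). Qed.
Lemma pmulNl x y : pmul (- x) y = - pmul x y.
Proof. exact: pliftN (pmul_resp y) x. Qed.
Lemma pmulDr : right_distributive pmul +%R.
Proof.
move=> x y z; elim/PHind: x => [c a||u v hu hv|u hu].
- by rewrite /pmul !(plift_gen (pmul_resp _)) pmulmD.
- by rewrite !pmul0l addr0.
- by rewrite !pmulDl hu hv addrACA.
- by rewrite !pmulNl hu opprD.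
Qed.
Lemma pmul0r x : pmul x 0 = 0.
Proof. by apply: (addIr (pmul x 0)); rewrite -pmulDr !add0r. Qed.
Lemma pmulNr x y : pmul x (- y) = - pmul x y.
Proof. by apply: (addrI (pmul x y)); rewrite -pmulDr !subrr pmul0r. Qed.

Lemma pmulA : associative pmul.
Proof.
move=> x y z; elim/PHind: x => [c a||u v hu hv|u hu].
- elim/PHind: y => [c' a'||u v hu hv|u hu].
  + elim/PHind: z => [c'' a''||u v hu hv|u hu].
    * by rewrite !ptensM !mulrA.
    * by rewrite !pmul0r.
    * by rewrite !pmulDr hu hv.
    * by rewrite !pmulNr hu.
  + by rewrite !(pmul0l, pmul0r).
  + by rewrite !(pmulDl, pmulDr) hu hv.
  + by rewrite !(pmulNl, pmulNr) hu.
- by rewrite !pmul0l.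
- by rewrite !pmulDl hu hv.
- by rewrite !pmulNl hu.
Qed.
Lemma pmul1l : left_id (ptens 1 1) pmul.
Proof.
move=> x; elim/PHind: x => [c a||x y hx hy|x hx].
- by rewrite ptensM !mul1r.
- by rewrite pmul0r.
- by rewrite pmulDr hx hy.
- by rewrite pmulNr hx.
Qed.
Lemma pmul1r : right_id (ptens 1 1) pmul.
Proof.
move=> x; elim/PHind: x => [c a||x y hx hy|x hx].
- by rewrite ptensM !mulr1.
- by rewrite pmul0l.
- by rewrite pmulDl hx hy.
- by rewrite pmulNl hx.
Qed.

Definition pdim : PH -> F := plift (fun p => p.1 * (gdim (val p.2))%:~R).
Lemma pdim_resp s t : tens_rel s t ->
  \sum_(p <- s) p.1 * (gdim (val p.2))%:~R =
  \sum_(p <- t) p.1 * (gdim (val p.2))%:~R :> F.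
Proof.
apply: (PHresp (f := fun p => p.1 * (gdim (val p.2))%:~R)) => u v w /=.
  by rewrite mulrDl.
by rewrite /gdim (pliftD (@gdim_resp _ T)) intrD mulrDr.
Qed.
Lemma PH1_neq0 : ptens 1 1 != 0.
Proof.
apply/eqP => /(congr1 pdim); rewrite /pdim (plift0 pdim_resp).
rewrite (plift_gen pdim_resp) /= /gdim (plift_gen (@gdim_resp _ T)) /= mul1r.
by move/eqP; rewrite oner_eq0.
Qed.

HB.instance Definition _ := GRing.Zmodule_isNzRing.Build PH
  pmulA pmul1l pmul1r pmulDl pmulDr PH1_neq0.

Lemma pscale_resp c s t : tens_rel s t ->
  \sum_(r <- s) ptens (c * r.1) r.2 = \sum_(r <- t) ptens (c * r.1) r.2.
Proof.
apply: (PHresp (f := fun r => ptens (c * r.1) r.2)) => u v w /=.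
  by rewrite mulrDr ptensDl.
by rewrite ptensDr.
Qed.
Lemma ptensZ c c' a : pscale c (ptens c' a) = ptens (c * c') a.
Proof. by rewrite /pscale (plift_gen (pscale_resp _)). Qed.
Lemma pscaleE c x : pscale c x = pmul (ptens c 1) x.
Proof.
elim/PHind: x => [c' a||x y hx hy|x hx].
- by rewrite ptensZ ptensM mul1r.
- by rewrite pmul0r /pscale (plift0 (pscale_resp _)).
- by rewrite pmulDr -hx -hy /pscale (pliftD (pscale_resp _)).
- by rewrite pmulNr -hx /pscale (pliftN (pscale_resp _)).
Qed.
Lemma ptens1C c x : pmul (ptens c 1) x = pmul x (ptens c 1).
Proof.
elim/PHind: x => [c' a||x y hx hy|x hx].
- by rewrite !ptensM mul1r mulr1 mulrC.
- by rewrite pmul0r pmul0l.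
- by rewrite pmulDr pmulDl hx hy.
- by rewrite pmulNr pmulNl hx.
Qed.

Lemma pscaleA a b v : pscale a (pscale b v) = pscale (a * b) v.
Proof. by rewrite !pscaleE pmulA ptensM mulr1. Qed.
Lemma pscale1 : left_id 1 pscale.
Proof. by move=> x; rewrite pscaleE pmul1l. Qed.
Lemma pscaleDr : right_distributive pscale +%R.
Proof. by move=> c x y; rewrite !pscaleE pmulDr. Qed.
Lemma pscaleDl v : {morph pscale^~ v : a b / a + b}.
Proof. by move=> a b; rewrite !pscaleE ptensDl pmulDl. Qed.
HB.instance Definition _ := GRing.Zmodule_isLmodule.Build F PH
  pscaleA pscale1 pscaleDr pscaleDl.

Lemma pscaleAl (c : F) (x y : PH) : c *: (x * y) = (c *: x) * y.
Proof.
by rewrite -[LHS]/(pscale _ (pmul _ _)) -[RHS]/(pmul (pscale _ _) _) !pscaleE pmulA.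
Qed.
HB.instance Definition _ := GRing.Lmodule_isLalgebra.Build F PH pscaleAl.
Lemma pscaleAr (c : F) (x y : PH) : c *: (x * y) = x * (c *: y).
Proof.
rewrite -[LHS]/(pscale _ (pmul _ _)) -[RHS]/(pmul _ (pscale _ _)) !pscaleE.
by rewrite !pmulA ptens1C.
Qed.
HB.instance Definition _ := GRing.Lalgebra_isAlgebra.Build F PH pscaleAr.
End ScalarExtension.

Section Generators.
Context (F : fieldType) {K : closedFieldType} {T : taft K}.
Context (w : K) (hw : (tn T).-primitive_root w).
Context (hwq : w ^+ (tn T %/ td T) = tq T).

Lemma le1d : (0 < 1 <= td T)%N. Proof. exact: ltnW (taft_d T). Qed.
Lemma ledd : (0 < td T <= td T)%N.
Proof. by rewrite leqnn andbT td_gt0. Qed.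

Lemma semisimple_dim1 (V : hmod T) : hdim V = 1%N -> semisimple V.
Proof.
case: V => N g h hg hh hgh /= e U _; move: U; rewrite /is_hsub /=; subst N => U.
have [->|U0] := eqVneq U 0%VS.
  by exists fullv => //=; [move=> u _; rewrite !memvf | rewrite add0v cap0v].
exists 0%VS => /=.
  by move=> u; rewrite memv0 => /eqP->; rewrite !mulmx0 mem0v.
rewrite addv0 capv0; split=> //; apply/eqP.
rewrite eqEdim subvf dimvf /dim /= muln1; move: U0; rewrite -dimv_eq0 lt0n //.
Qed.

Lemma hgactX (V : hmod T) (a : 'cV[K]_(hdim V)) (x : K) k :
  gact V *m a = x *: a ->
  gact V *m (hact V ^+ k *m a) = (x * tq T ^- k) *: (hact V ^+ k *m a).
Proof.
move=> ga; elim: k => [|k IH]; first by rewrite expr0 mul1mx invr1 mulr1.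
have q0 : tq T != 0 by rewrite (prim_root_eq0 (taft_q T)) -lt0n td_gt0.
rewrite exprS -[hact V * _]/(_ *m _) -mulmxA mulmxA.
have -> : gact V *m hact V = (tq T)^-1 *: (hact V *m gact V).
  by rewrite hgact scalerK.
rewrite -scalemxAl -mulmxA IH -scalemxAr scalerA; congr (_ *: _).
by rewrite exprS invfM mulrCA.
Qed.

Lemma homX (V W : hmod T) (f : 'M[K]_(hdim W, hdim V)) k : is_hom f ->
  f *m hact V ^+ k = hact W ^+ k *m f /\ f *m gact V ^+ k = gact W ^+ k *m f.
Proof.
move=> [fg fh]; elim: k => [|k [IH1 IH2]]; first by rewrite !expr0 mulmx1 mul1mx.
rewrite !exprS; split.
  by rewrite -[hact V * _]/(_ *m _) mulmxA fh -mulmxA IH1 mulmxA.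
by rewrite -[gact V * _]/(_ *m _) mulmxA fg -mulmxA IH2 mulmxA.
Qed.

Lemma col_mul a b c (A : 'M[K]_(a, b)) (B : 'M[K]_(b, c)) j :
  col j (A *m B) = A *m col j B.
Proof. by rewrite !colE mulmxA. Qed.

Lemma projective_indec (i : 'Z_(tn T)) : projective (indec hw hwq ledd i).
Proof.
move=> A B p f hp rp [/= fg fh].
have /row_freeP[s ps] : row_free p by rewrite /row_free rp.
pose o := Ordinal (@td_gt0 K T).
pose b := col o f; pose x := w ^+ i.
have n0 : (tn T)%:R != 0 :> K := prim_root_natf_neq0 hw.
have w0 : w != 0.
  by rewrite (prim_root_eq0 hw) -lt0n ltnW // taft_n.
have x0 : x != 0 by rewrite expf_neq0.
have xn : x ^+ tn T = 1 by rewrite /x exprAC (prim_expr_order hw) expr1n.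
have gb : gact B *m b = x *: b.
  rewrite /b !colE mulmxA -fg -mulmxA mul_diag_mx.
  rewrite scalemxAr; congr (_ *m _); apply/colP => k; rewrite !mxE.
  by case: eqP => [->|_]; rewrite ?mulr0 //= expr0 invr1 mulr1.
have gbX k : gact B ^+ k *m b = x ^+ k *: b.
  elim: k => [|k IH]; first by rewrite !expr0 mul1mx scale1r.
  rewrite exprS -[gact B * _]/(_ *m _) -mulmxA IH -scalemxAr gb scalerA.
  by rewrite -exprSr.
pose a : 'cV_(hdim A) :=
  (tn T)%:R^-1 *: \sum_(0 <= k < tn T) x ^- k *: (gact A ^+ k *m (s *m b)).
have pa : p *m a = b.
  rewrite /a -scalemxAr mulmx_sumr.
  rewrite (eq_bigr (fun _ => b)) => [|k _]; last first.
    rewrite -scalemxAr mulmxA (homX k hp).2 -mulmxA [p *m _]mulmxA ps mul1mx.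
    by rewrite gbX scalerA mulVf ?scale1r // expf_neq0.
  by rewrite sumr_const_nat subn0 -scaler_nat scalerA mulVf // scale1r.
have ga : gact A *m a = x *: a.
  rewrite /a -scalemxAr scalerA mulrC -scalerA; congr (_ *: _).
  rewrite mulmx_sumr scaler_sumr.
  pose G k := x *: (x ^- k *: (gact A ^+ k *m (s *m b))).
  rewrite (eq_bigr (fun k => G k.+1)) => [|k _]; last first.
    rewrite /G -scalemxAr mulmxA scalerA (exprS x) invfM mulVKf //.
    by rewrite (exprS (gact A)).
  rewrite -/(\sum_(0 <= k < tn T) G k).
  apply: (@addrI _ (G 0)); rewrite -big_nat_recl // big_nat_recr //= addrC.
  by congr (_ + _); rewrite /G xn gactX !expr0.
pose f' : 'M[K]_(hdim A, td T) := \matrix_(r, j) (hact A ^+ j *m a) r 0.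
have f'E j : col j f' = hact A ^+ j *m a.
  by apply/colP => r; rewrite !mxE.
have colh (N : nat) (M : 'M[K]_(N, td T)) (j : 'I_(td T)) :
    col j (M *m indec_h (td T)) =
    if insub j.+1 is Some j' then col j' M else 0.
  apply/colP => r; rewrite !mxE; case: insubP => [u _ uj|]; rewrite ?mxE.
    rewrite (bigD1 u) //= mxE uj eqxx mulr1 big1 ?addr0 // => v vu.
    rewrite mxE [(v : nat) == _](_ : _ = false) ?mulr0 //.
    by apply/negbTE; rewrite -uj.
  rewrite -leqNgt => hj; rewrite big1 // => v _; rewrite mxE.
  by rewrite ltn_eqF ?mulr0 // (leq_trans (ltn_ord v)).
have colf j : col j f = hact B ^+ j *m b.
  case: j => j; elim: j => [|j IH] hj.
    by rewrite expr0 mul1mx /b; congr (col _ _); apply: val_inj.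
  have hj' := ltnW hj; have := IH hj' => e.
  rewrite exprS -[hact B * _]/(_ *m _) -mulmxA -e -col_mul -fh colh insubT /=.
  by congr (col _ _); apply: val_inj.
have colP (N : nat) (M M' : 'M[K]_(N, td T)) :
    (forall j, col j M = col j M') -> M = M'.
  by move=> h; apply/matrixP => r j; have /colP/(_ r) := h j; rewrite !mxE.
exists f'; last by apply: colP => j; rewrite col_mul f'E colf mulmxA (homX j hp).1 -mulmxA pa.
split=> /=; apply: colP => j; last first.
  rewrite colh col_mul f'E mulmxA -[hact A *m _]exprS; case: insubP => [u _ uj|].
    by rewrite f'E uj.
  rewrite -leqNgt => hj.
  have -> : j.+1 = td T by apply/eqP; rewrite eqn_leq hj andbT.
  by rewrite hactX mul0mx.
rewrite [RHS]col_mul f'E (hgactX _ ga) -f'E.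
by apply/colP => r; rewrite /indec_g mul_mx_diag !mxE mulrC.
Qed.

(* [y = [M(1, -1)]] and [z = [M(d, 0)]]. *)
Definition Py : PH F T :=
  ptens 1 (pcls (or_intror (@semisimple_dim1 (indec hw hwq le1d (-1)) erefl))).
Definition Pz : PH F T := ptens 1 (pcls (or_introl (@projective_indec 0))).
End Generators.

(* [rep P N] is the type of P-module structures on the column space F^N. *)
Definition rep (F : fieldType) (P : algType F) (N : nat) :=
  {lrmorphism P -> 'M[F]_N}.

Section Representations.
Context {F : fieldType} {P : algType F}.

Definition rep_iso M N (rho : rep P M) (sigma : rep P N) :=
  exists (f : 'M[F]_(N, M)) (f' : 'M[F]_(M, N)),
    [/\ f *m f' = 1%:M, f' *m f = 1%:M &
        forall x, f *m rho x = sigma x *m f].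

Definition subrep N (rho : rep P N) (U : {vspace 'cV[F]_N}) :=
  forall x u, u \in U -> rho x *m u \in U.

Definition irreducible N (rho : rep P N) :=
  (0 < N)%N /\ forall U, subrep rho U -> U = 0%VS \/ U = fullv.

Definition indecomposable N (rho : rep P N) :=
  (0 < N)%N /\ forall U W, subrep rho U -> subrep rho W ->
    (U + W)%VS = fullv -> (U :&: W)%VS = 0%VS -> U = 0%VS \/ W = 0%VS.
End Representations.

(* [omegaC R n k] is exp(2 k pi i / n). *)
Definition omegaC (R : realType) (n k : nat) : R[i] :=
  (cos (k.*2%:R * pi / n%:R) +i* sin (k.*2%:R * pi / n%:R))%C.

(* Main.v *)
(* The projective class ring is Z[y, z] modulo the two displayed relations, and
   after that the representation theory is linear algebra.

   Structure of p(H).  M(d,0) (x) V depends only on the restriction of V to the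
   group algebra K[g]: v_j (x) u |-> h^j (v_0 (x) g^-j u) is unitriangular, so [h]
   may be replaced by 0 on V.  Taking V = M(d,0) gives z^2 = (1 + y^m + ...) z, and
   for V projective, V is a direct summand of M(d,0) (x) V, hence free over
   K[h]/(h^d); splitting off h-strings then shows that V is a sum of modules M(d,i).
   A semisimple module is killed by [h], hence a sum of modules M(1,i).  Thus p(H)
   is the Z-span of the y^i and y^i z.  Conversely, for matrices Y and Z satisfying
   the two relations, the multiplicities needed to define y |-> Y, z |-> Z are read
   off the additive invariants rank(g-weight space) and rank(h^(d-1) on it).

   Representations.  On an indecomposable one every idempotent commuting with Y and
   Z is 0 or 1.  The spectral projectors of Y force Y = omega_k, whence
   Z^2 = d Z or Z^2 = 0 according to whether d | k; the idempotent Z/d, resp. a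
   complement to a vector v or to the span of v and Zv, finishes the proof. *)

From HB Require Import structures.
Require Import Defs.
From mathcomp Require Import all_boot all_order all_algebra.
From mathcomp Require Import mxtens complex boolp reals trigo.
From mathcomp Require Import ring lra zify.
Set Implicit Arguments.
Unset Strict Implicit.
Unset Printing Implicit Defensive.
Import Order.TTheory GRing.Theory Num.Theory.
Local Open Scope ring_scope.

(** * Spectral projectors of a matrix of finite order *)

Section EigenProjectors.
Context {F : fieldType} (n : nat) (w : F) (hw : n.-primitive_root w).

(** The discrete Fourier projector onto the [w ^+ k]-eigenspace of a matrix [A] with
    [A ^+ n = 1]. *)
Definition eproj N (A : 'M[F]_N) (k : nat) : 'M[F]_N :=
  n%:R^-1 *: \sum_(j < n) w ^- (k * j) *: A ^+ j.

Lemma prim_root_neq0 : w != 0.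
Proof. by rewrite (prim_root_eq0 hw) -lt0n (prim_order_gt0 hw). Qed.

Lemma natn_neq0 : n%:R != 0 :> F.
Proof. exact: prim_root_natf_neq0 hw. Qed.

(** Orthogonality of characters of Z/n: if [n] does not divide [k], multiplying by [w ^+ k - 1]
    telescopes the sum to [w ^+ (k * n) - 1 = 0]. *)
Lemma sum_prim_rootX k :
  \sum_(j < n) w ^+ (k * j) = if (n %| k)%N then n%:R else 0.
Proof.
have [nk|nk] := ifPn.
  rewrite (eq_bigr (fun _ => 1)) => [|j _]; first by rewrite sumr_const card_ord.
  by apply/eqP; rewrite -(prim_order_dvd hw) dvdn_mulr.
have wk : w ^+ k - 1 != 0 by rewrite subr_eq0 -(prim_order_dvd hw).
apply: (mulfI wk); rewrite mulr0.
under eq_bigr do rewrite exprM.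
by rewrite -subrX1 -exprM mulnC exprM (prim_expr_order hw) expr1n subrr.
Qed.

(** [eproj A k] is a polynomial in [A] whose coefficients do not depend on [A]. *)
Lemma eproj_hom M N (A : 'M[F]_M) (B : 'M[F]_N) (f : 'M[F]_(N, M)) k :
  f *m A = B *m f -> f *m eproj A k = eproj B k *m f.
Proof.
move=> fA; rewrite /eproj -scalemxAl -scalemxAr mulmx_suml mulmx_sumr.
congr (_ *: _); apply: eq_bigr => j _; rewrite -scalemxAl -scalemxAr.
congr (_ *: _); elim: (j : nat) => [|i IH]; first by rewrite !expr0 mul1mx mulmx1.
by rewrite !exprSr -[_ * A]/(_ *m A) -[_ * B]/(_ *m B) mulmxA IH -!mulmxA fA.
Qed.

Section Projectors.
Context {N : nat} {A : 'M[F]_N} (An : A ^+ n = 1).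

Lemma mul_eproj k : A *m eproj A k = w ^+ k *: eproj A k.
Proof.
rewrite /eproj -scalemxAr scalerA mulrC -scalerA; congr (_ *: _).
rewrite mulmx_sumr scaler_sumr.
pose G j := w ^+ k *: (w ^- (k * j) *: A ^+ j).
rewrite (eq_bigr (fun j : 'I_n => G j.+1)) => [|j _]; last first.
  rewrite /G -scalemxAr scalerA mulnS exprD invfM mulVKf ?expf_neq0 ?prim_root_neq0 //.
  by rewrite (exprS A).
rewrite -/(\sum_(j < n) G j) -(big_mkord xpredT (fun j => G j.+1)).
(* Multiplication by [A] shifts the index; after adding [G 0] on both sides only [G n = G 0]
   remains. *)
rewrite -(big_mkord xpredT G); apply: (@addrI _ (G 0)).
rewrite -big_nat_recl // big_nat_recr //= addrC; congr (_ + _).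
by rewrite /G An muln0 !expr0 mulnC exprM (prim_expr_order hw) expr1n.
Qed.

Lemma eproj_comm (B : 'M[F]_N) k : A *m B = B *m A ->
  eproj A k *m B = B *m eproj A k.
Proof. by move=> AB; rewrite (eproj_hom k (esym AB)). Qed.

Lemma eproj_mul k : eproj A k *m A = w ^+ k *: eproj A k.
Proof. by rewrite (eproj_comm k (erefl (A *m A))) mul_eproj. Qed.

(** After exchanging the sums, the coefficient of [A ^+ j] is a character sum, which vanishes for
    [0 < j < n]. *)
Lemma sum_eproj : \sum_(k < n) eproj A k = 1.
Proof.
rewrite /eproj -scaler_sumr exchange_big /=.
under eq_bigr do rewrite -scaler_suml.
pose o := Ordinal (prim_order_gt0 hw).
rewrite (bigD1 o) //= [X in _ + X]big1 ?addr0.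
  rewrite (eq_bigr (fun _ => 1)) => [|i _]; last by rewrite muln0 expr0 invr1.
  by rewrite /= sumr_const card_ord expr0 scalerA mulVf ?scale1r // natn_neq0.
move=> j jo; rewrite (_ : \sum_(i < n) _ = 0) ?scale0r //.
(* [sum_prim_rootX] has natural exponents, so [w ^- (i * j)] is turned into [w ^+ ((n - j) * i)]. *)
have h : (n - j + j = n)%N by rewrite subnK // ltnW.
transitivity (\sum_(i < n) w ^+ ((n - j) * i)).
  apply: eq_bigr => i _; apply: (mulIf (expf_neq0 (i * j) prim_root_neq0)).
  rewrite mulVf ?expf_neq0 ?prim_root_neq0 // -exprD [(i * j)%N]mulnC -mulnDl h.
  by rewrite exprM (prim_expr_order hw) expr1n.
rewrite sum_prim_rootX ifN //.
have j0 : (0 < j)%N by rewrite lt0n; apply: contra jo => /eqP jo; apply/eqP/val_inj.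
by rewrite gtnNdvd ?subn_gt0 ?ltn_subrL ?j0 ?(prim_order_gt0 hw).
Qed.

Lemma eproj_fix M (B : 'M[F]_(N, M)) k :
  A *m B = w ^+ k *: B -> eproj A k *m B = B.
Proof.
move=> AB.
have AX j : A ^+ j *m B = w ^+ (k * j) *: B.
  elim: j => [|j IH]; first by rewrite expr0 mul1mx muln0 scale1r.
  by rewrite exprS -[A * _]/(A *m _) -mulmxA IH -scalemxAr AB scalerA -exprD -mulnSr.
rewrite /eproj -scalemxAl mulmx_suml (eq_bigr (fun _ => B)) => [|j _].
  by rewrite sumr_const card_ord -scaler_nat scalerA mulVf ?scale1r // natn_neq0.
by rewrite -scalemxAl AX scalerA mulVf ?scale1r // expf_neq0 // prim_root_neq0.
Qed.

(** In [eproj A k *m A *m B] the matrix [A] yields the factor [w ^+ k] when absorbed on the left and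
    [c] when absorbed on the right. *)
Lemma eproj_annul M (B : 'M[F]_(N, M)) c k :
  A *m B = c *: B -> c != w ^+ k -> eproj A k *m B = 0.
Proof.
move=> AB ck; have : (w ^+ k - c) *: (eproj A k *m B) = 0.
  by rewrite scalerBl scalemxAl -eproj_mul scalemxAr -AB mulmxA subrr.
by move/eqP; rewrite scaler_eq0 subr_eq0 eq_sym (negPf ck) => /eqP.
Qed.

Lemma eproj_idem k : eproj A k *m eproj A k = eproj A k.
Proof. exact: eproj_fix (mul_eproj k). Qed.
End Projectors.
End EigenProjectors.

(** * Splitting modules over the Taft algebra *)

Section Splitting.
Context {K : closedFieldType} {T : taft K}.
Local Notation n := (tn T).
Local Notation d := (td T).
Local Notation q := (tq T).
Implicit Types V W U : hmod T.

Lemma is_hom_inv V W (f : 'M[K]_(hdim W, hdim V)) (f' : 'M[K]_(hdim V, hdim W)) :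
  is_hom f -> f *m f' = 1%:M -> f' *m f = 1%:M -> is_hom f'.
Proof.
move=> [fg fh] ff' f'f.
have h A B : f *m A = B *m f -> f' *m B = A *m f'.
  move=> fA; rewrite -[LHS]mulmx1 -ff' mulmxA -[_ *m f]mulmxA -fA !mulmxA f'f.
  by rewrite mul1mx.
by split; apply: h.
Qed.

Lemma hiso_sym V W : hiso V W -> hiso W V.
Proof.
move=> [f [f' [hf ff' f'f]]]; exists f', f; split=> //.
exact: is_hom_inv hf ff' f'f.
Qed.

Lemma is_hom_comp U V W (f : 'M[K]_(hdim V, hdim U)) (e : 'M[K]_(hdim W, hdim V)) :
  is_hom f -> is_hom e -> is_hom (e *m f).
Proof.
move=> [fg fh] [eg eh]; split.
  by rewrite -mulmxA fg mulmxA eg -mulmxA.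
by rewrite -mulmxA fh mulmxA eh -mulmxA.
Qed.

(** Here [hsum V V] is isomorphic to [V], and the Green ring allows cancellation. *)
Lemma gcls_dim0 V : hdim V = 0 -> gcls V = 0.
Proof.
move=> V0; apply: (addIr (gcls V)); rewrite add0r -gcls_sum.
apply: gcls_iso; case: V V0 => N g h hg hh hgh /= N0; subst N.
by exists 0, 0; split; first split; apply/matrixP => -[].
Qed.

Section Corner.
Context {V : hmod T} {r : nat}.
Context {C : 'M[K]_(hdim V, r)} {D : 'M[K]_(r, hdim V)} (DC : D *m C = 1%:M).
Hypothesis Cg : C *m (D *m gact V) = gact V *m C *m D.
Hypothesis Ch : C *m (D *m hact V) = hact V *m C *m D.

Lemma cornerX (A : 'M[K]_(hdim V)) k : C *m (D *m A) = A *m C *m D ->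
  (D *m A *m C) ^+ k = D *m A ^+ k *m C.
Proof.
move=> CA; elim: k => [|k IH]; first by rewrite !expr0 mulmx1 DC.
rewrite exprSr IH -[_ * (_ *m C)]/(_ *m (_ *m C)) exprSr.
rewrite -[_ * A]/(_ *m A) !mulmxA -[_ *m C *m D *m A]mulmxA -[_ *m C *m _]mulmxA CA.
by rewrite -!mulmxA DC mulmx1.
Qed.

Lemma corner_gX : (D *m gact V *m C) ^+ n = 1.
Proof. by rewrite cornerX // gactX mulmx1 DC. Qed.
Lemma corner_hX : (D *m hact V *m C) ^+ d = 0.
Proof. by rewrite cornerX // hactX mulmx0 mul0mx. Qed.
Lemma corner_hg : (D *m hact V *m C) *m (D *m gact V *m C) =
  q *: ((D *m gact V *m C) *m (D *m hact V *m C)).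
Proof.
have h (A B : 'M[K]_(hdim V)) : C *m (D *m B) = B *m C *m D ->
    (D *m A *m C) *m (D *m B *m C) = D *m (A *m B) *m C.
  move=> CB; rewrite -!mulmxA [C *m _]mulmxA [C *m _ *m _]mulmxA -[_ *m B]mulmxA CB.
  by rewrite -!mulmxA DC mulmx1.
by rewrite !h // hgact -scalemxAr -scalemxAl.
Qed.
(** The image of the idempotent [C *m D], which commutes with the action, in the coordinates given
    by the columns of [C]. *)
Definition corner : hmod T := HMod corner_gX corner_hX corner_hg.

Lemma corner_incl : @is_hom _ _ corner V C.
Proof.
by split=> /=; rewrite !mulmxA -[_ *m D *m _]mulmxA ?Cg ?Ch -!mulmxA DC mulmx1.
Qed.
Lemma corner_proj : @is_hom _ _ V corner D.
Proof.
by split=> /=; rewrite -!mulmxA [_ *m (C *m D)]mulmxA -?Cg -?Ch !mulmxA DC mul1mx.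
Qed.
End Corner.

(** The complement of [U] is the image of the idempotent [1 - s p], with coordinates taken from a
    rank factorization of it. *)
Lemma retract_split V U (s : 'M[K]_(hdim V, hdim U)) (p : 'M[K]_(hdim U, hdim V)) :
  is_hom s -> is_hom p -> p *m s = 1%:M ->
  exists W (i : 'M[K]_(hdim V, hdim W)) (r : 'M[K]_(hdim W, hdim V)),
    [/\ is_hom i, is_hom r, r *m i = 1%:M, hiso V (hsum U W) &
        (hdim V = hdim U + hdim W)%N].
Proof.
move=> hs hp ps; have [sg sh] := hs; have [pg ph] := hp.
pose e := 1%:M - s *m p.
have ee : e *m e = e.
  rewrite /e mulmxBl mul1mx mulmxBr mulmx1 !mulmxA -[s *m p *m s]mulmxA ps mulmx1.
  by rewrite subrr subr0.
have CDe : col_base e *m row_base e = e := mulmx_base e.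
(* With C and D the two full-rank factors, [e *m e = e] reads C (D C) D = C D, and the outer factors
   cancel. *)
have DC : row_base e *m col_base e = 1%:M.
  apply: (row_full_inj (col_base_full e)); apply: (row_free_inj (row_base_free e)).
  by rewrite /= mulmxA -mulmxA CDe mulmx1 CDe ee.
have eg A : s *m p *m A = A *m s *m p ->
    col_base e *m (row_base e *m A) = A *m col_base e *m row_base e.
  move=> h; rewrite mulmxA CDe -[A *m _ *m _]mulmxA CDe /e.
  by rewrite mulmxBr mulmxBl mulmx1 mul1mx mulmxA h.
have Cg : col_base e *m (row_base e *m gact V) = gact V *m col_base e *m row_base e.
  by apply: eg; rewrite -mulmxA pg mulmxA sg.
have Ch : col_base e *m (row_base e *m hact V) = hact V *m col_base e *m row_base e.
  by apply: eg; rewrite -mulmxA ph mulmxA sh.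
have [W [i [r [hi hr ri ir]]]] : exists W (i : 'M[K]_(hdim V, hdim W))
    (r : 'M[K]_(hdim W, hdim V)), [/\ is_hom i, is_hom r, r *m i = 1%:M & i *m r = e].
  exists (corner DC Cg Ch), (col_base e), (row_base e).
  by split=> //; [exact: corner_incl | exact: corner_proj].
have [rg rh] := hr.
have pi : p *m i = 0.
  rewrite -[X in _ *m X]mulmx1 -ri !mulmxA -[p *m i *m r]mulmxA ir /e.
  by rewrite mulmxBr mulmx1 mulmxA ps mul1mx subrr mul0mx.
have rs : r *m s = 0.
  rewrite -[r]mul1mx -ri -[r *m i *m r]mulmxA ir -mulmxA /e.
  by rewrite mulmxBl mul1mx -mulmxA ps mulmx1 subrr mulmx0.
have iso : hiso V (hsum U W).
  exists (col_mx p r : 'M[K]_(hdim (hsum U W), hdim V)).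
  exists (row_mx s i : 'M[K]_(hdim V, hdim (hsum U W))); split.
  - split=> /=; rewrite mul_block_col !mul0mx addr0 add0r mul_col_mx ?pg ?ph;
      by rewrite ?rg ?rh.
  - by rewrite /= mul_col_row pi rs ps ri -scalar_mx_block.
  - by rewrite /= mul_row_col ir /e addrC subrK.
exists W, i, r; split=> //.
exact: hiso_dim iso.
Qed.
End Splitting.

(** Evaluates products with the shift matrix [indec_h]; the value 0 out of range is the convention
    [v_l = 0]. *)
Lemma sum_mul_delta (R : pzRingType) l (f : nat -> R) c :
  \sum_(b < l) f b * (b == c :> nat)%:R = if (c < l)%N then f c else 0.
Proof.
case: ltnP => hc.
  rewrite (bigD1 (Ordinal hc)) //= eqxx mulr1 big1 ?addr0 // => b bc.
  by rewrite [(b : nat) == c](negPf bc) mulr0.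
by rewrite big1 // => b _; rewrite ltn_eqF ?mulr0 // (leq_trans (ltn_ord b)).
Qed.

(** * Splitting off an h-string of maximal length *)

Section Jordan.
Context {K : closedFieldType} {T : taft K}.
Local Notation n := (tn T).
Local Notation d := (td T).
Local Notation q := (tq T).
Context (w : K) (hw : n.-primitive_root w) (hwq : w ^+ (n %/ d) = q).
Implicit Types V W U : hmod T.

Lemma tq_neq0 : q != 0.
Proof. exact: prim_root_neq0 (taft_q T). Qed.

Lemma hactX_g V k : hact V ^+ k *m gact V = q ^+ k *: (gact V *m hact V ^+ k).
Proof.
elim: k => [|k IH]; first by rewrite !expr0 mul1mx mulmx1 scale1r.
rewrite !exprS -[hact V * _]/(hact V *m _) -mulmxA IH -scalemxAr !mulmxA hgact.
by rewrite -scalemxAl scalerA mulrC.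
Qed.

(** The components of [hact V ^+ l] between [g]-weight spaces add up to it, so one of them is
    nonzero. A column and a row of the projectors involved give the eigenvector and eigencovector of
    [jordan_split]. *)
Lemma eproj_entry_neq0 V l : hact V ^+ l != 0 ->
  exists i j a b,
    (eproj n w (gact V) j *m hact V ^+ l *m eproj n w (gact V) i) a b != 0.
Proof.
have hs := @sum_eproj _ _ _ hw _ (gact V).
case: (pickP (fun p : 'I_n * 'I_n =>
  eproj n w (gact V) p.2 *m hact V ^+ l *m eproj n w (gact V) p.1 != 0)).
  by move=> [i j] /= /matrix0Pn[a [b h]] _; exists i, j, a, b.
move=> h /eqP[]; rewrite -[LHS]mul1mx -[X in X *m _]hs -[LHS]mulmx1.
rewrite -[X in _ *m X = _]hs mulmx_suml mulmx_suml big1 // => j _.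
rewrite mulmx_sumr big1 // => i _.
by have := h (i, j) => /negbFE/eqP.
Qed.

(* With [v] a [g]-eigenvector and [xi] a [g]-eigencovector such that
   [xi h^(l-1) v != 0], the maps [v_j |-> h^j v] and
   [x |-> (xi h^(l-1-k) x)_k] compose to a nonzero scalar of M(l, i). *)
Lemma jordan_split V l (hl : (0 < l <= d)%N) :
  hact V ^+ l = 0 -> hact V ^+ l.-1 != 0 ->
  exists i W (c : 'M[K]_(hdim V, hdim W)) (r : 'M[K]_(hdim W, hdim V)),
    [/\ is_hom c, is_hom r, r *m c = 1%:M, hiso V (hsum (indec hw hwq hl i) W) &
        (hdim V = l + hdim W)%N].
Proof.
move=> hl0 /eproj_entry_neq0[i [j [a [b]]]].
set vv := eproj _ _ _ i; set xx := eproj _ _ _ j => c0.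
pose v : 'cV_(hdim V) := col b vv; pose xi : 'rV_(hdim V) := row a xx.
have gv : gact V *m v = w ^+ i *: v.
  by rewrite /v colE mulmxA (mul_eproj hw (@gactX K T V)) -scalemxAl.
have xg : xi *m gact V = w ^+ j *: xi.
  by rewrite /xi rowE -mulmxA (eproj_mul hw (@gactX K T V)) -scalemxAr.
pose f k := (xi *m hact V ^+ k *m v) 0 0.
have {}c0 : f l.-1 != 0.
  by rewrite /f /v /xi rowE colE -!mulmxA -rowE mxE mulmxA mulmxA -colE mxE.
have f0 k : (l <= k)%N -> f k = 0.
  by move=> lk; rewrite /f -(subnK lk) exprD hl0 mulr0 mulmx0 mul0mx mxE.
have fe k : f k * w ^+ i = f k * (w ^+ j * q ^+ k).
  have : xi *m hact V ^+ k *m (gact V *m v) = xi *m (hact V ^+ k *m gact V) *m v.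
    by rewrite !mulmxA.
  rewrite gv hactX_g -!scalemxAr -scalemxAl !mulmxA xg -!scalemxAl scalerA.
  move/matrixP/(_ 0 0); rewrite mxE [RHS]mxE -/(f k) mulrC => ->.
  by rewrite mulrC [q ^+ k * _]mulrC.
have wij : w ^+ i = w ^+ j * q ^+ l.-1 by apply: (mulfI c0).
case/andP: (hl) => l0 ld.
(* If [f k] were nonzero, [fe] and [wij] would give [q ^+ k = q ^+ l.-1] with distinct exponents
   below the order [d] of [q]. *)
have fl k : (k < l.-1)%N -> f k = 0.
  move=> kl; apply/eqP; apply: contraT => /mulfI/(_ _ _ (fe k)).
  rewrite wij => /(mulfI (expf_neq0 _ (prim_root_neq0 hw)))/eqP.
  rewrite (eq_prim_root_expr (taft_q T)) !modn_small; lia.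
have i'P : exists i' : 'Z_n, w ^+ i' = w ^+ i.
  have hn := taft_n T.
  exists (inZp i); rewrite /= -(prim_expr_mod hw (i %% _)) Zp_cast ?modn_mod //.
  by rewrite (prim_expr_mod hw).
have [i' wi'] := i'P.
pose M := indec hw hwq hl i'.
pose s : 'M[K]_(hdim V, hdim M) := \matrix_(r, k) (hact V ^+ k *m v) r 0.
pose p : 'M[K]_(hdim M, hdim V) :=
  \matrix_(k, r) ((f l.-1)^-1 * (xi *m hact V ^+ (l.-1 - k)) 0 r).
have hs : is_hom s.
  split; apply/matrixP => r k.
    rewrite /= mul_mx_diag !mxE wi' mulrC.
    have /matrixP/(_ r 0) := hgactX k gv; rewrite !mxE => <-.
    by apply: eq_bigr => c _; rewrite !mxE.
  rewrite !mxE /=; transitivity ((hact V ^+ k.+1 *m v) r 0); last first.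
    rewrite exprS -[hact V * _]/(_ *m _) -mulmxA [LHS]mxE.
    by apply: eq_bigr => c _; rewrite !mxE.
  under eq_bigr do rewrite !mxE.
  rewrite (sum_mul_delta _ (fun c => \sum_j0 (hact V ^+ c) r j0 * v j0 0)).
  case: ltnP => kl; first by rewrite mxE.
  have -> : k.+1 = l by apply/eqP; rewrite eqn_leq kl ltn_ord.
  by rewrite hl0 mul0mx mxE.
have hp : is_hom p.
  split; apply/matrixP => k r.
    rewrite /= mul_diag_mx [RHS]mxE [(\row_j _) _ _]mxE [p k r]mxE wi'.
    transitivity ((f l.-1)^-1 * (xi *m hact V ^+ (l.-1 - k) *m gact V) 0 r).
      rewrite [in LHS]mxE [in RHS]mxE mulr_sumr.
      by apply: eq_bigr => c _; rewrite [p k c]mxE mulrA.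
    rewrite -mulmxA hactX_g -scalemxAr mulmxA xg -scalemxAl scalerA mxE mulrCA.
    congr (_ * _); rewrite wij -mulrA mulrC; congr (_ * _).
    have kl : (k <= l.-1)%N by have := ltn_ord k; rewrite /=; lia.
    by rewrite -{2}(subnK kl) exprD mulfK // expf_neq0 // tq_neq0.
  transitivity ((f l.-1)^-1 * (xi *m hact V ^+ (l.-1 - k) *m hact V) 0 r).
    rewrite [in LHS]mxE [in RHS]mxE mulr_sumr.
    by apply: eq_bigr => c _; rewrite [p k c]mxE mulrA.
  rewrite -mulmxA -[_ *m hact V]/(_ * hact V) -exprSr.
  rewrite [RHS]mxE /=; under eq_bigr => c _ do rewrite [indec_h _ _ _]mxE [p c r]mxE mulrC.
  case: k => -[|k] kl /=.
    by rewrite subn0 prednK // hl0 mulmx0 mxE mulr0 big1 // => c _; rewrite mulr0.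
  under eq_bigr => c _ do rewrite eqSS eq_sym.
  rewrite (sum_mul_delta _ (fun c => (f l.-1)^-1 * (xi *m hact V ^+ (l.-1 - c)) 0 r)).
  by rewrite (ltnW kl) -subSn ?subSS //; move: (kl) => /=; lia.
have ps : p *m s = 1%:M.
  (* The argument of [f] exceeds [l.-1] above the diagonal, where [f] vanishes by nilpotency, and is
     smaller below it, where [f] vanishes by weights. *)
  apply/matrixP => k k'; transitivity ((f l.-1)^-1 * f (l.-1 - k + k')%N).
    have -> : f (l.-1 - k + k')%N =
        ((xi *m hact V ^+ (l.-1 - k)) *m (hact V ^+ k' *m v)) 0 0.
      by rewrite /f exprD -[_ * hact V ^+ k']/(_ *m _) !mulmxA.
    rewrite !mxE mulr_sumr; apply: eq_bigr => c _.
    by rewrite [p k c]mxE [s c k']mxE mulrA.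
  have kl : (k < l)%N := ltn_ord k; have jl : (k' < l)%N := ltn_ord k'.
  have lt_e a1 a2 : (a1 < a2 < l)%N -> (l <= l.-1 - a1 + a2)%N by clear -l0; lia.
  have gt_e a1 a2 : (a2 < a1 < l)%N -> (l.-1 - a1 + a2 < l.-1)%N by clear -l0; lia.
  rewrite !mxE -val_eqE /=; case: (ssrnat.ltngtP k k') => kj.
  - by rewrite (f0 (_ + _)%N) ?mulr0 ?lt_e // kj jl.
  - by rewrite (fl (_ + _)%N) ?mulr0 ?gt_e // kj kl.
  - by rewrite -kj subnK ?mulVf // -ltnS prednK.
have [W [c [r [hc hr rc iso dm]]]] := retract_split hs hp ps.
by exists i', W, c, r.
Qed.
End Jordan.

(** * Tensoring with M(d,0) *)

Section Untwist.
Context {K : closedFieldType} {T : taft K}.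
Local Notation n := (tn T).
Local Notation d := (td T).
Local Notation q := (tq T).
Context (w : K) (hw : n.-primitive_root w) (hwq : w ^+ (n %/ d) = q).
Implicit Types V W U : hmod T.

Lemma hforget_hX V : (0 : 'M[K]_(hdim V)) ^+ d = 0.
Proof. by rewrite expr0n eqn0Ngt td_gt0. Qed.
Lemma hforget_hg V : (0 : 'M[K]_(hdim V)) *m gact V = q *: (gact V *m 0).
Proof. by rewrite mul0mx mulmx0 scaler0. Qed.
(** The restriction of [V] to K[g], inflated along the quotient map of the Taft algebra that kills
    [h]. *)
Definition hforget V : hmod T := HMod (gactX V) (hforget_hX V) (hforget_hg V).

Context (V : hmod T).
Let R := indec hw hwq (@ledd K T) 0.
Let H := htens_h R V.
Let o := Ordinal (@td_gt0 K T).
(** The inverse of [gact V ^+ k], written as a power with natural exponent. *)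
Let gi k := gact V ^+ (n.-1 * k).

Lemma gactK k : gact V ^+ k *m gi k = 1%:M.
Proof.
rewrite -[_ *m _]/(_ * _) -exprD -mulSn prednK; last exact: ltnW (taft_n T).
by rewrite exprM gactX expr1n.
Qed.

Lemma giS k : gi k.+1 *m gact V = gi k.
Proof.
rewrite -[_ *m _]/(_ * _) -exprSr mulnS -addSn prednK; last exact: ltnW (taft_n T).
by rewrite exprD gactX mul1r.
Qed.

(** The matrix unit sending [v_k] to [v_0]; the index is a plain natural number so that it can be
    shifted. *)
Definition row0_delta k : 'M[K]_d :=
  \matrix_(a, b) ((a == 0%N :> nat) && (b == k :> nat))%:R.
Definition untw_term k : 'M[K]_(hdim (htens R V)) :=
  H ^+ k *m (row0_delta k *t gi k).
(* Sends [v_j (x) u] to [h^j (v_0 (x) g^-j u)], which is [v_j (x) u] plus terms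
   [v_i (x) _] with [i < j]; it intertwines M(d,0) (x) V with [h] acting on V as 0
   and M(d,0) (x) V. *)
Definition untw : 'M[K]_(hdim (htens R V)) := \sum_(k < d) untw_term k.

Lemma tens_entry a b (A : 'M[K]_a) (B : 'M[K]_b) N (X : 'M[K]_(a * b, N)) i r c :
  ((A *t B) *m X) (mxtens_index (i, r)) c =
  \sum_s \sum_t A i s * B r t * X (mxtens_index (s, t)) c.
Proof.
rewrite mxE pair_bigA /= (reindex (@mxtens_index a b)) /=; last first.
  exists (@mxtens_unindex a b) => k _; [exact: mxtens_indexK | exact: mxtens_unindexK].
by apply: eq_bigr => -[s t] _; rewrite tensmxE.
Qed.

(** In the rows at [v_i] with [k <= i] the summand [1 (x) h] of [H] contributes nothing: every
    factor [H] acts through [h (x) g], so [v_0] climbs to [v_k] and collects [g ^+ k]. *)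
Lemma untw_entry k (j i : 'I_d) (a b : 'I_(hdim V)) (B : 'M[K]_(hdim V)) :
  (k <= i)%N ->
  (H ^+ k *m (row0_delta j *t B)) (mxtens_index (i, a)) (mxtens_index (j, b)) =
  (gact V ^+ k *m B) a b *+ (k == i).
Proof.
elim: k i a => [|k IH] i a ki.
  rewrite !expr0 !mul1mx tensmxE mxE eqxx andbT mulr_natl.
  by case: i ki => -[].
rewrite exprS -[H * _]/(H *m _) -mulmxA {1}/H /htens_h mulmxDl mxE !tens_entry.
rewrite [X in X + _]big1 ?add0r => [|s _]; last first.
  rewrite big1 // => t _; rewrite [(1%:M : 'M_d) _ _]mxE.
  case: eqP => [<-|]; last by rewrite !mul0r.
  by rewrite mul1r IH ?ltn_eqF ?mulr0n ?mulr0 // ltnW.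
case: i ki => -[|i] hi //= ki; have hi' := ltnW hi.
rewrite (bigD1 (Ordinal hi')) //= [X in _ + X]big1 ?addr0; last first.
  move=> s; rewrite -val_eqE /= => si; rewrite big1 // => t _.
  rewrite [indec_h _ _ _]mxE /= eqSS.
  by rewrite [(i : nat) == s]eq_sym (negPf si) !mul0r.
under eq_bigr => t _ do rewrite [indec_h _ _ _]mxE eqxx mul1r IH //=.
rewrite eqSS; under eq_bigr => t _ do rewrite mulrnAr.
rewrite sumrMnl; congr (_ *+ _).
by rewrite exprS -[gact V * _]/(_ *m _) -mulmxA [in RHS]mxE.
Qed.

Lemma untw_entry0 (k : nat) (j : 'I_d) (b : 'I_(hdim V)) r (X : 'M[K]_(d * hdim V)) B :
  k != j -> (X *m (row0_delta k *t B)) r (mxtens_index (j, b)) = 0.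
Proof.
move=> kj; rewrite mxE big1 // => s _; case: (mxtens_indexP s) => i a.
by rewrite tensmxE mxE [(j : nat) == k]eq_sym (negPf kj) andbF mul0r mulr0.
Qed.

Lemma untw_unit : untw \in unitmx.
Proof.
have e (i l : 'I_d) a b : (l <= i)%N ->
    untw (mxtens_index (i, a)) (mxtens_index (l, b)) = ((i == l) && (a == b))%:R.
  move=> li; rewrite /untw summxE (bigD1 l) //= big1 ?addr0; last first.
    by move=> j jl; apply: untw_entry0; rewrite val_eqE.
  rewrite /untw_term untw_entry // gactK mxE -val_eqE [(l : nat) == i]eq_sym.
  by rewrite -mulnb natrM mulr_natl mulrb; case: eqP.
(* In the lexicographic order of [mxtens_index] the matrix is upper unitriangular, while
   [is_trig_mx] means lower triangular. *)
have tr : is_trig_mx untw^T.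
  apply/is_trig_mxP => k; case: (mxtens_indexP k) => i a.
  move=> k'; case: (mxtens_indexP k') => l b /= h; rewrite mxE e.
    by case: andP h => // -[/eqP-> /eqP->]; rewrite ltnn.
  rewrite leqNgt; apply/negP => il; move: h; rewrite ltnNge => /negP; apply.
  rewrite (leq_trans (ltnW _) (leq_addr a _)) //.
  by rewrite (leq_trans _ (leq_mul il (leqnn _))) // mulSn addnC ltn_add2r.
rewrite unitmxE -det_tr (det_trig tr) big1 ?unitr1 // => k _.
by case: (mxtens_indexP k) => i a; rewrite mxE e // !eqxx.
Qed.

Lemma row0_delta_h k : (k.+1 < d)%N -> row0_delta k.+1 *m indec_h d = row0_delta k.
Proof.
move=> kd; apply/matrixP => a b; rewrite !mxE.
under eq_bigr => c _ do rewrite !mxE.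
rewrite (sum_mul_delta _ (fun c => ((a == 0%N :> nat) && (c == k.+1))%:R)) eqSS.
by case: ltnP => // bd; rewrite [(b : nat) == k]gtn_eqF ?andbF // -ltnS (leq_trans kd).
Qed.

Lemma row0_delta0_h : row0_delta 0 *m indec_h d = 0.
Proof.
apply/matrixP => a b; rewrite !mxE.
under eq_bigr => c _ do rewrite !mxE.
rewrite (sum_mul_delta _ (fun c => ((a == 0%N :> nat) && (c == 0%N))%:R)) andbF.
by case: ifP.
Qed.

Lemma row0_delta_g k : row0_delta k *m gact R = q ^- k *: row0_delta k.
Proof.
apply/matrixP => a b; rewrite /= mul_mx_diag !mxE expr0 mul1r mulrC.
by case: (b =P k :> nat) => [->|]; rewrite ?andbF ?mulr0.
Qed.

Lemma g_row0_delta k : gact R *m row0_delta k = row0_delta k.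
Proof.
apply/matrixP => a b; rewrite /= mul_diag_mx !mxE expr0 mul1r.
by case: (a =P 0%N :> nat) => [->|]; rewrite ?mulr0 // expr0 invr1 mul1r.
Qed.

(** As [h] acts on the source by [h (x) g], both composites with [h] send [v_k (x) u] to
    [h^(k+1) (v_0 (x) g^-k u)]. For [g], the weight [q ^- k] of [v_k] is the factor that arises when
    [g] moves past [H ^+ k]. *)
Lemma untw_hom : @is_hom _ _ (htens R (hforget V)) (htens R V) untw.
Proof.
have gS k : gi k *m gact V = gact V *m gi k.
  by rewrite -[_ *m _]/(_ * _) -[gact V *m _]/(_ * _) -exprSr -exprS.
split=> /=.
  rewrite /untw mulmx_suml mulmx_sumr; apply: eq_bigr => k _.
  rewrite /untw_term -mulmxA tensmx_mul row0_delta_g tensZl -scalemxAr.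
  have h : htens_g R V *m H ^+ k = q ^- k *: (H ^+ k *m htens_g R V).
    rewrite (@hactX_g _ _ (htens R V) k) scalerA mulVf ?scale1r //.
    by rewrite expf_neq0 // tq_neq0.
  rewrite mulmxA h.
  by rewrite -scalemxAl -mulmxA tensmx_mul g_row0_delta gS.
rewrite /htens_h /= tensmx0 add0r -/(htens_h R V) -/H.
rewrite /untw mulmx_suml mulmx_sumr.
rewrite -(big_mkord xpredT (fun k => untw_term k *m (indec_h d *t gact V))).
rewrite -(big_mkord xpredT (fun k => H *m untw_term k)).
have recl (A : nmodType) (F : nat -> A) l : (0 < l)%N ->
    \sum_(0 <= k < l) F k = F 0 + \sum_(0 <= k < l.-1) F k.+1.
  by case: l => // l _; rewrite big_nat_recl.
have recr (A : nmodType) (F : nat -> A) l : (0 < l)%N ->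
    \sum_(0 <= k < l) F k = \sum_(0 <= k < l.-1) F k + F l.-1.
  by case: l => // l _; rewrite big_nat_recr.
(* The two sums agree after an index shift; the leftover terms vanish by [row0_delta0_h] and by
   [H ^+ d = 0]. *)
rewrite (recl _ _ _ (@td_gt0 K T)) (recr _ _ _ (@td_gt0 K T)).
rewrite /untw_term -mulmxA tensmx_mul row0_delta0_h tens0mx mulmx0 add0r.
rewrite [H *m (_ *m _)]mulmxA -[H *m H ^+ _]exprS prednK ?td_gt0 //.
rewrite [H ^+ d]htens_hX mul0mx addr0 !big_mkord; apply: eq_bigr => k _.
rewrite -mulmxA tensmx_mul row0_delta_h ?giS; last by have := ltn_ord k; lia.
by rewrite exprS -[H * _]/(_ *m _) mulmxA.
Qed.

Lemma hiso_untw : hiso (htens R V) (htens R (hforget V)).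
Proof.
apply: hiso_sym; exists untw, (invmx untw); split; first exact: untw_hom.
  exact: mulmxV untw_unit.
exact: mulVmx untw_unit.
Qed.
End Untwist.

(** * The projective class ring *)

Section Classes.
Context {K : closedFieldType} {T : taft K}.
Local Notation n := (tn T).
Local Notation d := (td T).
Local Notation q := (tq T).
Context (w : K) (hw : n.-primitive_root w) (hwq : w ^+ (n %/ d) = q).
Implicit Types V W U : hmod T.

Lemma expw_oppZ k : w ^+ (- k%:R : 'Z_n)%R = w ^- k.
Proof.
have w0 := prim_root_neq0 hw; apply: (mulIf (expf_neq0 k w0)).
rewrite mulVf ?expf_neq0 // -exprD; apply/eqP; rewrite -(prim_order_dvd hw).
have hn := taft_n T.
have dvd_n s : s%:R = 0 :> 'Z_n -> (n %| s)%N.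
  by move/(congr1 val); rewrite /= val_Zp_nat // => /eqP.
by apply: dvd_n; rewrite natrD natr_Zp addNr.
Qed.

(* M(l, -k), so that tensoring with M(1, -1), i.e. multiplying by [y], increments
   [k]. *)
Definition taftmod l (hl : (0 < l <= d)%N) (k : nat) := indec hw hwq hl (- k%:R).
Definition gcls1 k := gcls (taftmod (@le1d K T) k).
Definition gclsd k := gcls (taftmod (@ledd K T) k).

Lemma tmod_surj l (hl : (0 < l <= d)%N) i : exists k, indec hw hwq hl i = taftmod hl k.
Proof. by exists (- i)%R; rewrite /taftmod natr_Zp opprK. Qed.

Lemma expq j : q ^+ j = w ^+ (j * (n %/ d)).
Proof. by rewrite -hwq -exprM mulnC. Qed.

Lemma tmod_gE l (hl : (0 < l <= d)%N) k i j :
  gact (taftmod hl k) i j = w ^- (k + i * (n %/ d)) *+ (i == j).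
Proof.
rewrite /= mxE mxE expw_oppZ expq exprD invfM.
by case: (i =P j) => [->|]; rewrite ?mulr0n.
Qed.

Lemma hiso_tmod1l l (hl : (0 < l <= d)%N) j k :
  hiso (htens (taftmod (@le1d K T) k) (taftmod hl j)) (taftmod hl (k + j)).
Proof.
apply: (@hiso_reindex _ _ (htens (taftmod (@le1d K T) k) (taftmod hl j))
   (taftmod hl (k + j)) (fun i => (mxtens_unindex i).2)).
- exists (fun i => mxtens_index (ord0, i)) => i; last by rewrite mxtens_indexK.
  by case: (mxtens_indexP i) => a b; rewrite mxtens_indexK (ord1 a).
- move=> a b; rewrite [LHS]tensE !tmod_gE !ord1 eqxx mul0n addn0.
  by rewrite mulrnAr -invfM -exprD addnA.
- move=> a b; rewrite /= /htens_h mxE [X in X + _]tensE [X in _ + X]tensE.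
  rewrite [indec_h 1 _ _]mxE !ord1 mul0r addr0.
  by rewrite [(1%:M : 'M_1) _ _]mxE mul1r.
Qed.

(** Here [h] acts by [h (x) g], that is, by [h] scaled by [w ^- k]; rescaling [v_a] by
    [w ^+ (k * a)] removes the scalar. *)
Lemma hiso_tmod1r l (hl : (0 < l <= d)%N) j k :
  hiso (htens (taftmod hl j) (taftmod (@le1d K T) k)) (taftmod hl (k + j)).
Proof.
set V := htens _ _; set W := taftmod hl (k + j).
have w0 := prim_root_neq0 hw.
pose P : 'M[K]_(hdim W, hdim V) := \matrix_(a, i) (a == (mxtens_unindex i).1)%:R.
have PE N (X : 'M[K]_(N, hdim W)) a i b : (X *m P) a (mxtens_index (i, b)) = X a i.
  rewrite mxE (bigD1 i) //= big1 ?addr0 => [|c ci].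
    by rewrite mxE mxtens_indexK eqxx mulr1.
  by rewrite mxE mxtens_indexK (negPf ci) mulr0.
have PPt : P *m P^T = 1%:M.
  apply/matrixP => a b; rewrite mxE (bigD1 (mxtens_index (b, ord0))) //=.
  rewrite [X in _ + X]big1 ?addr0 => [|i]; first by rewrite !mxE mxtens_indexK eqxx mulr1.
  case: (mxtens_indexP i) => i1 i2; rewrite (ord1 i2) => ib.
  rewrite [P^T _ _]mxE [P b _]mxE mxtens_indexK /=.
  by case: (eqVneq b i1) ib => [->|_ _]; rewrite ?eqxx ?mulr0.
have PtP : P^T *m P = 1%:M.
  apply/matrixP => i; case: (mxtens_indexP i) => i1 i2 a; case: (mxtens_indexP a) => a1 a2.
  rewrite PE !mxE mxtens_indexK (can_eq (@mxtens_indexK _ _)) xpair_eqE.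
  by rewrite (ord1 i2) (ord1 a2) eqxx andbT eq_sym.
pose D : 'M[K]_(hdim W) := diag_mx (\row_a w ^+ (k * a)).
pose D' : 'M[K]_(hdim W) := diag_mx (\row_a w ^- (k * a)).
have DD' : D *m D' = 1%:M.
  rewrite mulmx_diag; apply/matrixP => a b; rewrite !mxE mulfV ?expf_neq0 //.
have D'D : D' *m D = 1%:M.
  rewrite mulmx_diag; apply/matrixP => a b; rewrite !mxE mulVf ?expf_neq0 //.
exists (D *m P), (P^T *m D'); split.
- have Pt X Y : P *m (X *t Y) = Y 0 0 *: (X *m P) :> 'M[K]_(hdim W, hdim V).
    apply/matrixP => a i; case: (mxtens_indexP i) => i1 i2.
    rewrite mxE [RHS]mxE PE (bigD1 (mxtens_index (a, ord0))) //= big1 ?addr0.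
      by rewrite tensmxE mxE mxtens_indexK eqxx mul1r (ord1 i2) mulrC.
    move=> c; case: (mxtens_indexP c) => c1 c2; rewrite (ord1 c2) => ca.
    rewrite [P _ _]mxE mxtens_indexK /=.
    by case: (eqVneq a c1) ca => [->|_ _]; rewrite ?eqxx ?mul0r.
  split.
    have gW : gact W = w ^- k *: gact (taftmod hl j).
      apply/matrixP => a b; rewrite [RHS]mxE !tmod_gE mulrnAr -invfM -exprD.
      by rewrite addnA.
    rewrite -mulmxA [P *m _]Pt tmod_gE eqxx mul0n addn0 !mulmxA -scalemxAr gW.
    by rewrite -!scalemxAl mulmxA [D *m _]diag_mxC.
  have Dh : w ^- k *: (D *m hact (taftmod hl j)) = hact W *m D.
    apply/matrixP => a b; rewrite [LHS]mxE mul_diag_mx mul_mx_diag !mxE.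
    case: eqP => [->|_]; last by rewrite mul0r !mulr0.
    by rewrite mul1r mulr1 mulnS exprD mulKf ?expf_neq0.
  rewrite -mulmxA [P *m _]mulmxDr !Pt tmod_gE eqxx mul0n addn0.
  rewrite [hact (taftmod _ k) _ _]mxE scale0r add0r -scalemxAr !mulmxA scalemxAl Dh.
  by [].
- by rewrite !mulmxA -[D *m P *m _]mulmxA PPt mulmx1.
- by rewrite !mulmxA -[P^T *m D' *m _]mulmxA D'D mulmx1.
Qed.

End Classes.

(** * Multiplication table for the classes of M(1,i) and M(d,i) *)

Section Table.
Context {K : closedFieldType} {T : taft K}.
Local Notation n := (tn T).
Local Notation d := (td T).
Local Notation q := (tq T).
Context (w : K) (hw : n.-primitive_root w) (hwq : w ^+ (n %/ d) = q).
Implicit Types V W U : hmod T.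
Local Notation tmod := (taftmod hw hwq).
Local Notation cls1 := (gcls1 hw hwq).
Local Notation clsd := (gclsd hw hwq).

Lemma cls1M k j : cls1 k * cls1 j = cls1 (k + j).
Proof. by rewrite [LHS]gclsM; apply/gcls_iso/hiso_tmod1l. Qed.
Lemma cls1_clsd k j : cls1 k * clsd j = clsd (k + j).
Proof. by rewrite [LHS]gclsM; apply/gcls_iso/hiso_tmod1l. Qed.
Lemma clsd_cls1 k j : clsd j * cls1 k = clsd (k + j).
Proof. by rewrite [LHS]gclsM; apply/gcls_iso/hiso_tmod1r. Qed.

Lemma cls1_0 : cls1 0 = 1.
Proof.
apply: gcls_iso; apply: (@hiso_reindex _ _ (tmod (@le1d K T) 0) (hunit) id).
- by exists id.
- by move=> i j; rewrite tmod_gE !ord1 eqxx mul0n expr0 invr1 mxE eqxx.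
- by move=> i j; rewrite !mxE !ord1.
Qed.

Lemma cls1X k : cls1 k = cls1 1 ^+ k.
Proof.
elim: k => [|k IH]; first by rewrite cls1_0 expr0.
by rewrite exprS -IH cls1M.
Qed.

Lemma tmod_modn l (hl : (0 < l <= d)%N) : tmod hl n = tmod hl 0.
Proof.
rewrite /taftmod; congr indec; congr (- _).
by apply: val_inj; rewrite /= val_Zp_nat ?taft_n // modnn.
Qed.

Lemma cls1_n : cls1 1 ^+ n = 1.
Proof. by rewrite -cls1X /gcls1 tmod_modn -cls1_0. Qed.

Lemma clsdX k : clsd k = cls1 1 ^+ k * clsd 0.
Proof. by rewrite -cls1X cls1_clsd addn0. Qed.

Section DiagonalModule.
Context (N : nat) (a : nat -> nat).
Definition dmod_g : 'M[K]_N := diag_mx (\row_i w ^- a i).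
Lemma dmod_gX : dmod_g ^+ n = 1.
Proof.
have h k : dmod_g ^+ k = diag_mx (\row_i (w ^- a i) ^+ k).
  elim: k => [|k IH]; first by rewrite expr0; apply/matrixP => i j; rewrite !mxE.
  rewrite exprS IH -[LHS]/(_ *m _) mulmx_diag; congr diag_mx.
  by apply/rowP => j; rewrite !mxE exprS.
rewrite h; apply/matrixP => i j; rewrite !mxE -exprVn exprAC exprVn.
by rewrite (prim_expr_order hw) invr1 expr1n.
Qed.
Lemma dmod_hX : (0 : 'M[K]_N) ^+ d = 0.
Proof. by rewrite expr0n eqn0Ngt td_gt0. Qed.
Lemma dmod_hg : (0 : 'M[K]_N) *m dmod_g = q *: (dmod_g *m 0).
Proof. by rewrite mul0mx mulmx0 scaler0. Qed.
(** The direct sum of the M(1, -a_i) with i < N as one module, to be compared entrywise with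
    [hforget]. *)
Definition dmod : hmod T := HMod dmod_gX dmod_hX dmod_hg.
End DiagonalModule.

Lemma gcls_dmod N a : gcls (dmod N a) = \sum_(i < N) cls1 (a i).
Proof.
elim: N a => [|N IH] a; first by rewrite big_ord0 gcls_dim0.
rewrite big_ord_recl -(IH (a \o S)) -gcls_sum; apply: gcls_iso.
apply: (@hiso_reindex _ _ (dmod N.+1 a)
  (hsum (tmod (@le1d K T) (a 0)) (dmod N (a \o S))) id).
- by exists id.
- move=> i j; case: (@split_ordP 1 N i) => i' ->; case: (@split_ordP 1 N j) => j' ->.
  + rewrite [RHS]block_mxEul tmod_gE !ord1 !mxE eqxx mul0n addn0.
    by rewrite -val_eqE.
  + by rewrite [RHS]block_mxEur !mxE -val_eqE /= !ord1.
  + by rewrite [RHS]block_mxEdl !mxE -val_eqE /= !ord1.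
  + by rewrite [RHS]block_mxEdr !mxE -!val_eqE.
- move=> i j; case: (@split_ordP 1 N i) => i' ->; case: (@split_ordP 1 N j) => j' ->.
  + by rewrite [RHS]block_mxEul !mxE !ord1.
  + by rewrite [RHS]block_mxEur !mxE.
  + by rewrite [RHS]block_mxEdl !mxE.
  + by rewrite [RHS]block_mxEdr !mxE.
Qed.

Lemma gcls_hforget k :
  gcls (hforget (tmod (@ledd K T) k)) = \sum_(j < d) cls1 (k + j * (n %/ d)).
Proof.
rewrite -(gcls_dmod d (fun j => k + j * (n %/ d))%N); apply: gcls_iso.
set W := dmod _ _.
apply: (@hiso_reindex _ _ (hforget (tmod (@ledd K T) k)) W id).
- by exists id.
- by move=> i j; rewrite tmod_gE !mxE.
- by move=> i j; rewrite !mxE.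
Qed.

Lemma clsd0M V : clsd 0 * gcls V = clsd 0 * gcls (hforget V).
Proof.
rewrite [LHS]gclsM [RHS]gclsM /gclsd /taftmod.
rewrite (_ : - 0%:R = 0) ?oppr0 //; exact/gcls_iso/hiso_untw.
Qed.

(** By [clsd0M] the second factor may be restricted to K[g], where its weights are [w ^- (j * m)]
    with [m = n %/ d], because [q = w ^+ m]. *)
Lemma clsd00 : clsd 0 * clsd 0 = \sum_(j < d) cls1 1 ^+ (j * (n %/ d)) * clsd 0.
Proof.
rewrite [LHS]clsd0M gcls_hforget mulr_sumr; apply: eq_bigr => j _.
by rewrite add0n clsd_cls1 clsdX addn0.
Qed.
End Table.

(** * Classes of semisimple and of projective modules *)

Section ProjectiveClasses.
Context {K : closedFieldType} {T : taft K}.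
Local Notation n := (tn T).
Local Notation d := (td T).
Local Notation q := (tq T).
Context (w : K) (hw : n.-primitive_root w) (hwq : w ^+ (n %/ d) = q).
Implicit Types V W U : hmod T.
Local Notation tmod := (taftmod hw hwq).
Local Notation cls1 := (gcls1 hw hwq).
Local Notation clsd := (gclsd hw hwq).

Lemma hom_hactX V W (f : 'M[K]_(hdim W, hdim V)) k : is_hom f ->
  f *m hact V ^+ k = hact W ^+ k *m f.
Proof. by move=> hf; case: (homX k hf). Qed.

(** Copies of M(1,i) are split off one at a time by [jordan_split] with [l = 1]; the complement is a
    retract, hence again killed by [h]. *)
Lemma gcls_h0 V : hact V = 0 -> exists s : seq nat, gcls V = \sum_(k <- s) cls1 k.
Proof.
move: {2}(hdim V) (leqnn (hdim V)) => N; elim: N V => [|N IH] V VN h0.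
  by exists [::]; rewrite big_nil gcls_dim0 //; apply/eqP; rewrite -leqn0.
have [V0|Vp] := posnP (hdim V); first by exists [::]; rewrite big_nil gcls_dim0.
have h1 : hact V ^+ 1.-1 != 0.
  rewrite expr0; apply/matrix0Pn; exists (Ordinal Vp), (Ordinal Vp).
  by rewrite mxE eqxx oner_neq0.
have hl : hact V ^+ 1 = 0 by rewrite expr1.
have [i [W [c [r [hc hr rc iso dm]]]]] := jordan_split hw hwq (@le1d K T) hl h1.
have hW : hact W = 0.
  by rewrite -[LHS]mulmx1 -rc mulmxA -(hr.2) h0 mulmx0 mul0mx.
have [|s sE] := IH W _ hW; first by rewrite -ltnS (leq_trans _ VN) // dm.
have [k kE] := tmod_surj hw hwq (@le1d K T) i.
by exists (k :: s); rewrite (gcls_iso iso) gcls_sum kE sE big_cons.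
Qed.

Lemma hact_nil_inj V :
  (forall x : 'cV_(hdim V), hact V *m x = 0 -> x = 0) -> hdim V = 0%N.
Proof.
move=> inj; have h k (x : 'cV_(hdim V)) : hact V ^+ k *m x = 0 -> x = 0.
  elim: k => [|k IH]; first by rewrite expr0 mul1mx.
  by rewrite exprS -[hact V * _]/(_ *m _) -mulmxA => /inj/IH.
have [//|Vp] := posnP (hdim V).
have /h/matrixP/(_ (Ordinal Vp) 0) :
    hact V ^+ d *m (const_mx 1 : 'cV[K]_(hdim V)) = 0 by rewrite hactX mul0mx.
by rewrite !mxE => /eqP; rewrite oner_eq0.
Qed.

(** The kernel of [h] is a submodule because [h g = q g h]. On a complement [h] is injective and
    nilpotent, so the complement is zero. *)
Lemma semisimple_h0 V : semisimple V -> hact V = 0.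
Proof.
move=> ss; pose hh : 'End('cV[K]_(hdim V)) := linfun (mulmx (hact V)).
have kerP u : (u \in lker hh) = (hact V *m u == 0) by rewrite memv_ker lfunE.
have sub : is_hsub (lker hh).
  move=> u; rewrite !kerP => /eqP hu; split; last by rewrite hu mulmx0.
  by rewrite mulmxA hgact -scalemxAl -mulmxA hu mulmx0 scaler0.
have [U' sU' [Uf U0]] := ss _ sub.
have U'X k u : u \in U' -> hact V ^+ k *m u = 0 -> u = 0.
  elim: k u => [|k IH] u uU; first by rewrite expr0 mul1mx.
  rewrite exprSr -[_ * hact V]/(_ *m _) -mulmxA => /IH.
  case: (sU' u uU) => _ hu /(_ hu) h0.
  have : u \in (lker hh :&: U')%VS by rewrite memv_cap uU kerP h0 eqxx.
  by rewrite U0 memv0 => /eqP.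
have U'0 : U' = 0%VS.
  apply/eqP; rewrite -subv0; apply/subvP => u uU.
  by rewrite memv0 (U'X d u) // hactX mul0mx.
have full : lker hh = fullv by rewrite -Uf U'0 addv0.
apply/matrixP => i j; have : delta_mx j 0 \in lker hh by rewrite full memvf.
rewrite kerP => /eqP/matrixP/(_ i 0); rewrite -colE !mxE //.
Qed.

(* Higman's trace criterion for [V] to be free over [K[h]/(h^d)]; in this form it
   visibly passes to direct summands. *)
Definition higman V := exists t : 'M[K]_(hdim V),
  \sum_(a < d) hact V ^+ a *m t *m hact V ^+ (d.-1 - a) = 1%:M.

Lemma higman_retract V U (s : 'M[K]_(hdim V, hdim U)) (p : 'M[K]_(hdim U, hdim V)) :
  is_hom s -> is_hom p -> p *m s = 1%:M -> higman V -> higman U.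
Proof.
move=> hs hp ps [t tE]; exists (p *m t *m s).
rewrite -ps -[p in RHS]mulmx1 -tE mulmx_sumr mulmx_suml; apply: eq_bigr => a _.
rewrite !mulmxA -(hom_hactX _ hp) -!mulmxA; congr (_ *m (_ *m (_ *m _))).
exact: hom_hactX.
Qed.

Lemma higman_iso V U : hiso V U -> higman V -> higman U.
Proof.
move=> [f [f' [hf ff' f'f]]].
exact: higman_retract (is_hom_inv hf ff' f'f) hf ff'.
Qed.

(** If [h ^+ d.-1] were zero, the trace sum would kill every [x] with [h x = 0]: all terms but the
    last end in [h], and the last begins with [h ^+ d.-1]. Then [h] would be injective. *)
Lemma higman_top_neq0 V : higman V -> (0 < hdim V)%N -> hact V ^+ d.-1 != 0.
Proof.
move=> [t tE] Vp; apply/eqP => h0.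
have : hdim V = 0%N.
  apply: hact_nil_inj => x hx.
  rewrite -[x]mul1mx -tE mulmx_suml big1 // => a _.
  rewrite -!mulmxA; case E : (d.-1 - a)%N => [|b]; last first.
    by rewrite exprSr -[_ * hact V]/(_ *m _) -mulmxA hx !mulmx0.
  have -> : a = d.-1 :> nat by have := ltn_ord a; lia.
  by rewrite h0 mul0mx.
by move=> e; rewrite e in Vp.
Qed.

(** The top power of [h] is nonzero, so a string of full length [d] splits off; the complement
    inherits the trace criterion. *)
Lemma gcls_higman V : higman V -> exists s : seq nat, gcls V = \sum_(k <- s) clsd k.
Proof.
move: {2}(hdim V) (leqnn (hdim V)) => N; elim: N V => [|N IH] V VN hV.
  by exists [::]; rewrite big_nil gcls_dim0 //; apply/eqP; rewrite -leqn0.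
have [V0|Vp] := posnP (hdim V); first by exists [::]; rewrite big_nil gcls_dim0.
have h1 := higman_top_neq0 hV Vp.
have [i [W [c [r [hc hr rc iso dm]]]]] := jordan_split hw hwq (@ledd K T) (hactX V) h1.
have [|s sE] := IH W _ (higman_retract hc hr rc hV).
  by rewrite -ltnS (leq_trans _ VN) // dm -[X in (X < _)%N]add0n ltn_add2r td_gt0.
have [k kE] := tmod_surj hw hwq (@ledd K T) i.
by exists (k :: s); rewrite (gcls_iso iso) gcls_sum kE sE big_cons.
Qed.

Let R := indec hw hwq (@ledd K T) 0.
Let o := Ordinal (@td_gt0 K T).

Lemma indec_hX_entry k i j :
  (indec_h d ^+ k) i j = (i == (j + k)%N :> nat)%:R :> K.
Proof.
elim: k i j => [|k IH] i j; first by rewrite addn0 mxE -val_eqE.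
rewrite exprS mxE; under eq_bigr => c _ do rewrite IH mxE.
rewrite (sum_mul_delta _ (fun c => (i == c.+1 :> nat)%:R)) addnS; case: ltnP => // dk.
by rewrite ltn_eqF // (leq_trans (ltn_ord i)) // ltnW.
Qed.

Lemma higman_free V : hact V = 0 -> higman (htens R V).
Proof.
move=> h0; pose b := gact V ^+ (n.-1 * d.-1).
have gb : gact V ^+ d.-1 *m b = 1%:M.
  rewrite -[_ *m _]/(_ * _) -exprD -mulSn prednK; last exact: ltnW (taft_n T).
  by rewrite exprM gactX expr1n.
have hE k : hact (htens R V) ^+ k = (indec_h d ^+ k) *t (gact V ^+ k).
  by rewrite /= /htens_h h0 tensmx0 add0r tensmxX.
have ld : (d.-1 < d)%N by rewrite prednK ?td_gt0.
(* As [h] acts by [h (x) g], the term at [a] is the matrix unit at [(a, a)] tensored with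
   [g^a g^-(d-1) g^(d-1-a) = 1], and the matrix units add up to the identity. *)
exists (delta_mx o (Ordinal ld) *t b).
under eq_bigr => a _.
  rewrite !hE !tensmx_mul.
  have -> : gact V ^+ a *m b *m gact V ^+ (d.-1 - a) = 1%:M.
    rewrite -gb -[_ *m _ *m _]/(_ * _ * _) -!exprD -[RHS]exprD; congr (_ ^+ _).
    by have := ltn_ord a; lia.
  over.
rewrite -tensmx11; apply/matrixP => k l; rewrite summxE.
case: (mxtens_indexP k) => i i'; case: (mxtens_indexP l) => j j'.
under eq_bigr => a _ do rewrite tensmxE.
rewrite tensmxE -mulr_suml; congr (_ * _).
have ent (a : 'I_d) : (indec_h d ^+ a *m delta_mx o (Ordinal ld) *m
    indec_h d ^+ (d.-1 - a)) i j = ((i == a :> nat) && (j == a :> nat))%:R :> K.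
  rewrite -(mul_delta_mx (0 : 'I_1)) mulmxA -colE -mulmxA -rowE mxE big_ord1.
  rewrite !mxE !indec_hX_entry /= add0n -natrM mulnb; congr (_ && _)%:R.
  by have := ltn_ord a; lia.
rewrite (eq_bigr _ (fun a _ => ent a)) (bigD1 i) //= eqxx big1 ?addr0.
  by rewrite mxE eq_sym -val_eqE.
by move=> a ai; rewrite [(i : nat) == a]eq_sym val_eqE (negPf ai).
Qed.

(** The coordinate of [v_0] maps M(d,0) onto the trivial module. Tensored with [V] this is a
    surjection onto [V], which splits, so [V] is a retract of M(d,0) (x) [V]; untwisting reduces the
    criterion to [higman_free]. *)
Lemma projective_higman V : projective V -> higman V.
Proof.
move=> pV.
have [f [f' [hf ff' f'f]]] := hiso_unitl V.
pose eps : 'M[K]_(1, d) := delta_mx 0 o.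
pose iot : 'M[K]_(d, 1) := delta_mx o 0.
have ei : eps *m iot = 1%:M.
  by rewrite mul_delta_mx; apply/matrixP => i j; rewrite !ord1 !mxE.
pose p : 'M[K]_(hdim V, hdim (htens R V)) := f *m (eps *t 1%:M).
have he : @is_hom _ _ (htens R V) (htens hunit V) (eps *t 1%:M).
  split=> /=.
    rewrite !tensmx_mul mulmx1 mul1mx; congr (_ *t _).
    apply/matrixP => i j; rewrite mul1mx mul_mx_diag !mxE !ord1.
    by case: (j =P o) => [->|]; rewrite ?mul0r // expr0 invr1 !mulr1.
  rewrite mulmxDl mulmxDr !tensmx_mul !mulmx1 !mul1mx; congr (_ + _ *t _).
  apply/matrixP => i j; rewrite mul0mx !mxE big1 // => c _; rewrite !mxE.
  by case: (c =P o) => [->|]; rewrite ?mulr0 ?andbF ?mul0r.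
have hp : is_hom p by apply: is_hom_comp he hf.
have rp : \rank p = hdim V.
  apply/eqP/row_freeP; exists ((iot *t 1%:M) *m f').
  by rewrite mulmxA -[p *m _]mulmxA tensmx_mul ei mulmx1 tensmx11 mulmx1.
have h1 : @is_hom _ _ V V 1%:M by split; rewrite mulmx1 mul1mx.
have [s hs ps] := pV _ _ p 1%:M hp rp h1.
apply: higman_retract hs hp ps _.
apply: (higman_iso (hiso_sym (hiso_untw hw hwq V))).
exact: higman_free.
Qed.
End ProjectiveClasses.

(** * Additive invariants of modules *)

Lemma eproj_block (F : fieldType) n (w : F) a b (A : 'M[F]_a) (B : 'M[F]_b) k :
  eproj n w (block_mx A 0 0 B) k = block_mx (eproj n w A k) 0 0 (eproj n w B k).
Proof.
have h : \sum_(j < n) w ^- (k * j) *: block_mx A 0 0 B ^+ j =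
    block_mx (\sum_(j < n) w ^- (k * j) *: A ^+ j) 0
             0 (\sum_(j < n) w ^- (k * j) *: B ^+ j).
  elim/big_rec3: _ => [|j x x' u _ ->]; first by rewrite block_mx0.
  have -> : block_mx A 0 0 B ^+ j = block_mx (A ^+ j) 0 0 (B ^+ j).
    elim: (j : nat) => [|i IH]; first by rewrite !expr0 -scalar_mx_block.
    rewrite !exprS IH -[LHS]/(_ *m _) mulmx_block.
    by rewrite !mulmx0 !mul0mx !addr0 !add0r.
  by rewrite scale_block_mx !scaler0 add_block_mx !addr0.
by rewrite /eproj h scale_block_mx !scaler0.
Qed.

Lemma mxrank_conj (F : fieldType) M N (f : 'M[F]_(N, M)) f' (X : 'M[F]_M) (Y : 'M[F]_N) :
  f *m f' = 1%:M -> f' *m f = 1%:M -> f *m X = Y *m f -> \rank X = \rank Y.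
Proof.
move=> ff' f'f fX; apply/eqP; rewrite eqn_leq.
have -> : X = f' *m Y *m f by rewrite -mulmxA -fX mulmxA f'f mul1mx.
rewrite (leq_trans (mxrankM_maxl _ _) (mxrankM_maxr _ _)) /=.
have {1}-> : Y = f *m (f' *m Y *m f) *m f'.
  by rewrite !mulmxA ff' mul1mx -mulmxA ff' mulmx1.
exact: leq_trans (mxrankM_maxl _ _) (mxrankM_maxr _ _).
Qed.

Lemma prim_rootV (F : fieldType) n (w : F) :
  n.-primitive_root w -> n.-primitive_root w^-1.
Proof.
move=> hw; case/andP: (hw) => n0 _; apply/andP; split=> //.
apply/forallP => i; rewrite unity_rootE exprVn invr_eq1 -unity_rootE.
by case/andP: hw => _ /forallP.
Qed.

Section Character.
Context {K : closedFieldType} {T : taft K}.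
Local Notation n := (tn T).
Local Notation d := (td T).
Local Notation q := (tq T).
Local Notation m := (n %/ d)%N.
Context (w : K) (hw : n.-primitive_root w) (hwq : w ^+ (n %/ d) = q).
Implicit Types V W U : hmod T.
Local Notation tmod := (taftmod hw hwq).
Local Notation cls1 := (gcls1 hw hwq).
Local Notation clsd := (gclsd hw hwq).
(** The projectors are taken for [w^-1] so that M(1, -k), on which [g] acts by [w ^- k], is seen at
    index [k %% n]. *)
Local Notation P V i := (eproj n w^-1 (gact V) i).
Let hwV := prim_rootV hw.

Section Additive.
Context {B : zmodType} (f g : nat -> B).

Definition wt_term V : B := \sum_(i < n) f i *+ \rank (P V i).
Definition soc_term V : B := \sum_(i < n) g i *+ \rank (P V i *m hact V ^+ d.-1).

Lemma wt_term_iso V W : hiso V W -> wt_term V = wt_term W.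
Proof.
move=> [e [e' [[eg eh] ee' e'e]]]; apply: eq_bigr => i _; congr (_ *+ _).
exact: (mxrank_conj ee' e'e) (eproj_hom _ _ _ eg).
Qed.

Lemma wt_term_sum V W : wt_term (hsum V W) = wt_term V + wt_term W.
Proof.
rewrite -big_split; apply: eq_bigr => i _ /=.
by rewrite eproj_block rank_diag_block_mx mulrnDr.
Qed.

Lemma soc_term_iso V W : hiso V W -> soc_term V = soc_term W.
Proof.
move=> [e [e' [he ee' e'e]]]; apply: eq_bigr => i _; congr (_ *+ _).
apply: (mxrank_conj ee' e'e).
by rewrite mulmxA (eproj_hom _ _ _ he.1) -!mulmxA (hom_hactX _ he).
Qed.

Lemma soc_term_sum V W : soc_term (hsum V W) = soc_term V + soc_term W.
Proof.
rewrite -big_split; apply: eq_bigr => i _ /=.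
rewrite eproj_block block_diagX mulmx_block !mulmx0 !mul0mx !addr0 add0r.
by rewrite rank_diag_block_mx mulrnDr.
Qed.

(* The first term sees the [g]-weights of [V], the second the [g]-weights of
   [h^(d-1) V], hence how often each M(d,i) occurs; on the projective class ring
   these two invariants separate the basis [y^i], [y^i z]. *)
Definition charge : green T -> B := plift (fun V => wt_term V + soc_term V).

Lemma charge_resp s t : green_rel s t ->
  \sum_(V <- s) (wt_term V + soc_term V) = \sum_(V <- t) (wt_term V + soc_term V).
Proof.
apply: green_resp => V W; first by move=> h; rewrite (wt_term_iso h) (soc_term_iso h).
by rewrite wt_term_sum soc_term_sum addrACA.
Qed.
Lemma wt_resp s t : green_rel s t ->
  \sum_(V <- s) wt_term V = \sum_(V <- t) wt_term V.
Proof. exact: green_resp wt_term_iso wt_term_sum _ _. Qed.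

Lemma charge_cls V : charge (gcls V) = wt_term V + soc_term V.
Proof. exact: plift_gen charge_resp V. Qed.
Lemma chargeB x y : charge (x - y) = charge x - charge y.
Proof. by rewrite /charge (pliftD charge_resp) (pliftN charge_resp). Qed.
Lemma charge0 : charge 0 = 0.
Proof. exact: plift0 charge_resp. Qed.
Lemma chargeD x y : charge (x + y) = charge x + charge y.
Proof. exact: pliftD charge_resp x y. Qed.
Lemma charge_sum I (r : seq I) (x : I -> green T) :
  charge (\sum_(i <- r) x i) = \sum_(i <- r) charge (x i).
Proof. exact: (big_morph charge chargeD charge0). Qed.

Lemma sum_periodic (u : nat -> B) k (x : nat -> bool) :
  (forall i, (i < n)%N -> x i = (i == k %% n)%N) ->
  \sum_(i < n) u i *+ x i = u (k %% n)%N.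
Proof.
move=> xE; have kn : (k %% n < n)%N by rewrite ltn_mod ltnW ?taft_n.
rewrite (bigD1 (Ordinal kn)) //= xE // eqxx big1 ?addr0 // => i.
by rewrite -val_eqE xE //= => /negPf->.
Qed.

Lemma eproj_eig N (A : 'M[K]_N) M (X : 'M[K]_(N, M)) k i : (i < n)%N ->
  A ^+ n = 1 -> A *m X = w ^- k *: X -> eproj n w^-1 A i *m X = X *+ (i == k %% n)%N.
Proof.
move=> hi An AX; case: eqP => [->|ik].
  by apply: (eproj_fix hwV); rewrite exprVn (prim_expr_mod hw).
apply: (eproj_annul hwV An AX); rewrite -exprVn (eq_prim_root_expr hwV).
by rewrite [X in _ == X]modn_small // eq_sym; apply/eqP.
Qed.

Lemma wt_term1 k : wt_term (tmod (@le1d K T) k) = f (k %% n)%N.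
Proof.
rewrite /wt_term -(@sum_periodic f k (fun i => i == k %% n)%N) //.
apply: eq_bigr => i _; congr (_ *+ _).
rewrite -[P _ _]mulmx1 (eproj_eig (k := k)) ?gactX //; last first.
  apply/matrixP => a b; rewrite mulmx1 [RHS]mxE tmod_gE !ord1 eqxx mul0n addn0.
  by rewrite mxE mulr1.
by case: (_ == _); rewrite ?mxrank1 ?mxrank0.
Qed.

Lemma soc_term1 k : soc_term (tmod (@le1d K T) k) = 0.
Proof.
apply: big1 => i _.
have -> : hact (tmod (@le1d K T) k) = 0 by apply/matrixP => a b; rewrite !mxE !ord1.
by rewrite expr0n eqn0Ngt -ltnS prednK ?td_gt0 // taft_d mulmx0 mxrank0.
Qed.

(** The image of [h ^+ d.-1] is the line of [v_(d-1)], on which [g] acts by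
    [w ^- (k + d.-1 * m)]. *)
Lemma soc_termd k : soc_term (tmod (@ledd K T) k) = g ((k + d.-1 * m) %% n)%N.
Proof.
set k' := (k + _)%N.
rewrite /soc_term -(@sum_periodic g k' (fun i => i == k' %% n)%N) //.
apply: eq_bigr => i _; congr (_ *+ _).
have ld : (d.-1 < d)%N by rewrite prednK ?td_gt0.
have hE : hact (tmod (@ledd K T) k) ^+ d.-1 = delta_mx (Ordinal ld) (Ordinal (@td_gt0 K T)).
  apply/matrixP => a b; rewrite /= indec_hX_entry mxE -!val_eqE /=; congr _%:R.
  have : (a < d)%N := ltn_ord a; move: (nat_of_ord a) (nat_of_ord b) => {}a {}b; lia.
rewrite (eproj_eig (k := k')) ?gactX //; last first.
  have -> : gact (tmod (@ledd K T) k) = diag_mx (\row_j w ^- (k + j * m)).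
    by apply/matrixP => a b; rewrite tmod_gE !mxE.
  rewrite hE; apply/matrixP => a b; rewrite mul_diag_mx [LHS]mxE [RHS]mxE.
  rewrite ![delta_mx _ _ _ _]mxE [(\row_j _) _ _]mxE.
  by case: (a =P _) => [->|_] //=; rewrite !mulr0.
by rewrite hE; case: (_ == _); rewrite ?mxrank_delta ?mxrank0.
Qed.

Lemma wt_termd k :
  wt_term (tmod (@ledd K T) k) = \sum_(j < d) f ((k + j * m) %% n)%N.
Proof.
(* The first invariant depends on [g] alone, so forgetting [h] leaves it unchanged by
   computation. *)
transitivity (wt_term (hforget (tmod (@ledd K T) k))); first by [].
rewrite -(plift_gen wt_resp) -/(gcls _) gcls_hforget.
rewrite (big_morph _ (pliftD wt_resp) (plift0 wt_resp)).
by apply: eq_bigr => j _; rewrite (plift_gen wt_resp) wt_term1.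
Qed.

Lemma charge_cls1 k : charge (cls1 k) = f (k %% n)%N.
Proof. by rewrite charge_cls wt_term1 soc_term1 addr0. Qed.
Lemma charge_clsd k : charge (clsd k) =
  \sum_(j < d) f ((k + j * m) %% n)%N + g ((k + d.-1 * m) %% n)%N.
Proof. by rewrite charge_cls wt_termd soc_termd. Qed.
End Additive.
End Character.

(** * Generators and relations of P(H) *)

Section Span.
Context {K : closedFieldType} {T : taft K}.
Local Notation n := (tn T).
Local Notation d := (td T).
Local Notation q := (tq T).
Local Notation m := (n %/ d)%N.
Context (w : K) (hw : n.-primitive_root w) (hwq : w ^+ (n %/ d) = q).
Local Notation cls1 := (gcls1 hw hwq).
Local Notation clsd := (gclsd hw hwq).

(* The Z-span of [y^k] and [y^k z], which turns out to be the projective class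
   ring. *)
Inductive gspan : green T -> Prop :=
| gspan1 k : gspan (cls1 k)
| gspand k : gspan (clsd k)
| gspanB x y : gspan x -> gspan y -> gspan (x - y).

Lemma gspan0 : gspan 0.
Proof. by rewrite -(subrr (cls1 0)); apply: gspanB; exact: gspan1. Qed.
Lemma gspanN x : gspan x -> gspan (- x).
Proof. by move=> sx; rewrite -sub0r; apply: gspanB gspan0 sx. Qed.
Lemma gspanD x y : gspan x -> gspan y -> gspan (x + y).
Proof. by move=> sx sy; rewrite -[y]opprK; apply: gspanB sx (gspanN sy). Qed.
Lemma gspan_sum I (r : seq I) (x : I -> green T) :
  (forall i, gspan (x i)) -> gspan (\sum_(i <- r) x i).
Proof.
by move=> sx; elim/big_rec: _ => [|i y _ sy]; [exact: gspan0 | exact: gspanD].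
Qed.

Lemma clsdM k j : clsd k * clsd j = \sum_(i < d) clsd (k + j + i * m).
Proof.
rewrite [clsd k]clsdX [clsd j]clsdX -cls1X -(cls1X _ _ j) -mulrA [clsd 0 * _]mulrA.
rewrite clsd_cls1 -(cls1_clsd _ _ j 0) -[_ * _ * clsd 0]mulrA clsd00.
rewrite mulrA cls1M mulr_sumr; apply: eq_bigr => i _.
by rewrite -cls1X !cls1_clsd addn0.
Qed.

Lemma gspanM x y : gspan x -> gspan y -> gspan (x * y).
Proof.
elim=> {x} [k|k|x x' _ IH _ IH'] sy; last by rewrite mulrBl; apply: gspanB; auto.
  elim: sy => {y} [j|j|y y' _ IH _ IH']; last by rewrite mulrBr; apply: gspanB.
    by rewrite cls1M; exact: gspan1.
  by rewrite cls1_clsd; exact: gspand.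
elim: sy => {y} [j|j|y y' _ IH _ IH']; last by rewrite mulrBr; apply: gspanB.
  by rewrite clsd_cls1; exact: gspand.
by rewrite clsdM; apply: gspan_sum => i; exact: gspand.
Qed.

(** By the multiplication table the span is a subring, and it contains the classes of projective and
    of semisimple modules; the projective class ring is the smallest such subring. *)
Lemma pcr_gspan x : x \in @pcr_pred K T -> gspan x.
Proof.
move/asboolP => /(_ (fun x => `[< gspan x >])).
move=> h; apply/asboolP; apply: h => [|V hV].
  split=> [|x' y' /asboolP sx /asboolP sy|x' y' /asboolP sx /asboolP sy]; apply/asboolP.
  - by rewrite -(cls1_0 hw hwq); exact: gspan1.
  - exact: gspanB.
  - exact: gspanM.
apply/asboolP; case: hV.
  move=> /(projective_higman hw hwq)/(gcls_higman hw hwq)[s ->].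
  by apply: gspan_sum => k; exact: gspand.
move=> /semisimple_h0/(gcls_h0 hw hwq)[s ->].
by apply: gspan_sum => k; exact: gspan1.
Qed.

Context {F : fieldType}.
Local Notation P := (PH F T).
Local Notation y := (Py F hw hwq).
Local Notation z := (Pz F hw hwq).

(** Names the ring element behind [y], so that computations see its class but not the proof of
    semisimplicity. *)
Lemma val_Py : {a : pcr T | y = ptens 1 a & val a = cls1 1}.
Proof.
pose M := indec hw hwq (@le1d K T) (-1).
by exists (pcls (or_intror (@semisimple_dim1 _ _ M erefl))).
Qed.
Lemma val_Pz : {a : pcr T | z = ptens 1 a & val a = clsd 0}.
Proof.
exists (pcls (or_introl (@projective_indec _ _ _ hw hwq 0))) => //.
by rewrite /gclsd /taftmod (_ : - 0%:R = 0) ?oppr0.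
Qed.

Lemma ptens1M (a b : pcr T) : ptens (1 : F) (a * b) = ptens 1 a * ptens 1 b.
Proof. by rewrite -[RHS]/(pmul _ _) ptensM mulr1. Qed.
Lemma ptens1X (a : pcr T) k : ptens (1 : F) (a ^+ k) = ptens 1 a ^+ k.
Proof. by elim: k => // k IH; rewrite !exprS ptens1M IH. Qed.
Lemma ptens1B (a b : pcr T) : ptens (1 : F) (a - b) = ptens 1 a - ptens 1 b.
Proof. by apply: (addIr (ptens 1 b)); rewrite -ptensDr !subrK. Qed.
Lemma ptens_scale (c : F) (a : pcr T) : ptens c a = c *: ptens 1 a.
Proof. by rewrite -[RHS]/(pscale _ _) ptensZ mulr1. Qed.

(** Generation by [y] and [z], phrased as an induction principle so that intertwining and stability
    need checking only on generators. *)
Lemma PH_gen (Q : P -> Prop) : Q 1 -> Q y -> Q z ->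
  (forall a b, Q a -> Q b -> Q (a + b)) -> (forall c a, Q a -> Q (c *: a)) ->
  (forall a b, Q a -> Q b -> Q (a * b)) -> forall x, Q x.
Proof.
move=> Q1 Qy Qz QD QZ QM.
have QX a k : Q a -> Q (a ^+ k) by move=> Qa; elim: k => // k IH; rewrite exprS; apply: QM.
have QN a : Q a -> Q (- a) by rewrite -scaleN1r; exact: QZ.
have [ya yE yv] := val_Py; have [za zE zv] := val_Pz.
have h g : gspan g -> exists2 a : pcr T, val a = g & Q (ptens 1 a).
  elim=> {g} [k|k|g g' _ [a <- Qa] _ [b <- Qb]].
  - by exists (ya ^+ k); rewrite ?rmorphXn /= ?yv -?cls1X // ptens1X -yE; exact: QX.
  - exists (ya ^+ k * za); first by rewrite rmorphM rmorphXn /= yv zv -clsdX.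
    by rewrite ptens1M ptens1X -yE -zE; apply: QM Qz; exact: QX.
  - by exists (a - b); rewrite ?rmorphB // ptens1B; apply: QD Qa _; exact: QN.
move=> x; elim/PHind: x => [c a||a b Qa Qb|a Qa].
- rewrite ptens_scale; apply: QZ; have [b ab Qb] := h _ (pcr_gspan (valP a)).
  by rewrite -(val_inj ab).
- by rewrite -(scale0r 1); exact: QZ.
- exact: QD.
- exact: QN.
Qed.

Lemma Py_n : y ^+ n = 1.
Proof.
have [ya -> yv] := val_Py; rewrite -ptens1X; congr ptens.
by apply: val_inj; rewrite rmorphXn rmorph1 /= yv cls1_n.
Qed.
Lemma Pyz : y * z = z * y.
Proof.
have [ya -> yv] := val_Py; have [za -> zv] := val_Pz; rewrite -!ptens1M; congr ptens.
by apply: val_inj; rewrite !rmorphM /= yv zv cls1_clsd clsd_cls1.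
Qed.
Lemma Pzz : z * z = \sum_(j < d) y ^+ (j * m) * z.
Proof.
have [ya -> yv] := val_Py; have [za -> zv] := val_Pz.
rewrite -ptens1M; under eq_bigr => j _ do rewrite -ptens1X -ptens1M.
have p0 : ptens (1 : F) (0 : pcr T) = 0 by rewrite -(subrr 1) ptens1B subrr.
rewrite -(big_morph _ (ptensDr 1) p0); congr ptens.
apply: val_inj; rewrite rmorphM rmorph_sum /= zv clsd00.
by apply: eq_bigr => j _; rewrite -yv -[sval _]/(val (ya ^+ (j * m))) rmorphXn.
Qed.
End Span.

(** * Constructing representations of P(H) *)

Section Universal.
Context {K : closedFieldType} {T : taft K}.
Local Notation n := (tn T).
Local Notation d := (td T).
Local Notation q := (tq T).
Local Notation m := (n %/ d)%N.
Context (w : K) (hw : n.-primitive_root w) (hwq : w ^+ (n %/ d) = q).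
Local Notation cls1 := (gcls1 hw hwq).
Local Notation clsd := (gclsd hw hwq).
Context {F : fieldType} {N : nat} (Y Z : 'M[F]_N).
Hypothesis Yn : Y ^+ n = 1.
Hypothesis YZ : Y * Z = Z * Y.
Hypothesis ZZ : Z * Z = \sum_(j < d) Y ^+ (j * m) * Z.

Let Nm := \sum_(j < d) Y ^+ (j * m).
(** The weights must send [cls1 k] to [Y ^+ k], and so contribute [Y ^+ k * Nm] to [clsd k]. The
    socle, at index [k + d.-1 * m], has to supply the missing [Y ^+ k * (Z - Nm)]; the shift by [m]
    completes that index to [k + n]. *)
Let phi : green T -> 'M[F]_N :=
  charge w (fun i => Y ^+ i) (fun i => Y ^+ (i + m) * (Z - Nm)).

Lemma expYmod k : Y ^+ (k %% n) = Y ^+ k.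
Proof.
by rewrite [in RHS](divn_eq k n) exprD mulnC exprM Yn expr1n mul1r.
Qed.

Lemma phi_cls1 k : phi (cls1 k) = Y ^+ k.
Proof. by rewrite /phi charge_cls1 expYmod. Qed.

Lemma phi_clsd k : phi (clsd k) = Y ^+ k * Z.
Proof.
rewrite /phi charge_clsd exprD expYmod -exprD -addnA.
have -> : (d.-1 * m + m = n)%N.
  by rewrite addnC -mulSn prednK ?td_gt0 // mulnC divnK ?taft_dvd.
rewrite exprD Yn mulr1 mulrBr /Nm mulr_sumr addrC.
under [X in _ + X]eq_bigr => j _ do rewrite expYmod exprD.
by rewrite subrK.
Qed.

(** Checked on the spanning classes, where the multiplication table turns into the relations between
    [Y] and [Z]. *)
Lemma phiM x y : gspan hw hwq x -> gspan hw hwq y -> phi (x * y) = phi x * phi y.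
Proof.
have phiB a b : phi (a - b) = phi a - phi b := @chargeB _ _ w _ _ _ a b.
have ZYX k : Z * Y ^+ k = Y ^+ k * Z.
  elim: k => [|k IH]; first by rewrite mulr1 mul1r.
  by rewrite exprS mulrA -YZ -mulrA IH mulrA.
move=> sx sy; elim: sx => {x} [k|k|x x' _ IH _ IH'].
- elim: sy => {y} [j|j|y y' _ IH _ IH']; last by rewrite mulrBr !phiB mulrBr IH IH'.
    by rewrite cls1M !phi_cls1 exprD.
  by rewrite cls1_clsd !phi_clsd phi_cls1 exprD mulrA.
- elim: sy => {y} [j|j|y y' _ IH _ IH']; last by rewrite mulrBr !phiB mulrBr IH IH'.
    by rewrite clsd_cls1 !phi_clsd phi_cls1 -[_ * Z * _]mulrA ZYX mulrA -exprD addnC.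
  have -> : phi (clsd k * clsd j) = \sum_(i < d) phi (clsd (k + j + i * m)).
    by rewrite clsdM; exact: charge_sum.
  under eq_bigr => i _ do rewrite phi_clsd exprD -mulrA.
  rewrite -mulr_sumr -ZZ !phi_clsd exprD !mulrA; congr (_ * _).
  by rewrite -!mulrA ZYX.
- by rewrite mulrBl !phiB mulrBl IH IH'.
Qed.

Definition PH_lift : PH F T -> 'M[F]_N := plift (fun p => p.1 *: phi (val p.2)).

Lemma PH_lift_resp s t : tens_rel s t ->
  \sum_(p <- s) p.1 *: phi (val p.2) = \sum_(p <- t) p.1 *: phi (val p.2).
Proof.
apply: (PHresp (f := fun p => p.1 *: phi (val p.2))) => a b c /=.
  by rewrite scalerDl.
by rewrite /phi chargeD // scalerDr.
Qed.

Lemma PH_lift_tens c a : PH_lift (ptens c a) = c *: phi (val a).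
Proof. exact: plift_gen PH_lift_resp (c, a). Qed.
Lemma PH_liftD x y : PH_lift (x + y) = PH_lift x + PH_lift y.
Proof. exact: pliftD PH_lift_resp x y. Qed.
Lemma PH_lift0 : PH_lift 0 = 0.
Proof. exact: plift0 PH_lift_resp. Qed.
Lemma PH_liftN x : PH_lift (- x) = - PH_lift x.
Proof. exact: pliftN PH_lift_resp x. Qed.

Lemma PH_liftM x y : PH_lift (x * y) = PH_lift x * PH_lift y.
Proof.
rewrite -[x * y]/(pmul x y); elim/PHind: x => [c a||a b Qa Qb|a Qa].
- elim/PHind: y => [c' a'||a' b' Qa Qb|a' Qa].
  + have [sa sa'] := (pcr_gspan hw hwq (valP a), pcr_gspan hw hwq (valP a')).
    by rewrite ptensM !PH_lift_tens rmorphM /= (phiM sa sa') sqmxZl sqmxZr scalerA.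
  + by rewrite pmul0r PH_lift0 mulr0.
  + by rewrite pmulDr !PH_liftD mulrDr Qa Qb.
  + by rewrite pmulNr !PH_liftN mulrN Qa.
- by rewrite pmul0l PH_lift0 mul0r.
- by rewrite pmulDl !PH_liftD mulrDl Qa Qb.
- by rewrite pmulNl !PH_liftN mulNr Qa.
Qed.

Lemma PH_lift_scalar c : PH_lift (ptens c 1) = c *: (1 : 'M[F]_N).
Proof. by rewrite PH_lift_tens rmorph1 -(cls1_0 hw hwq) phi_cls1. Qed.

Lemma PH_lift1 : PH_lift 1 = 1.
Proof. by rewrite [LHS]PH_lift_scalar scale1r. Qed.

Lemma PH_liftZ c x : PH_lift (c *: x) = c *: PH_lift x.
Proof.
rewrite -[c *: x]/(pscale c x) pscaleE [LHS]PH_liftM PH_lift_scalar.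
by rewrite sqmxZl mul1r.
Qed.

Lemma PH_lift_y : PH_lift (Py F hw hwq) = Y.
Proof.
by have [a -> av] := @val_Py _ _ _ hw hwq F; rewrite PH_lift_tens av phi_cls1 scale1r.
Qed.
Lemma PH_lift_z : PH_lift (Pz F hw hwq) = Z.
Proof.
by have [a -> av] := @val_Pz _ _ _ hw hwq F; rewrite PH_lift_tens av phi_clsd mul1r scale1r.
Qed.

(** The universal property of the presentation by [y] and [z]; all representations of the list are
    built from it. *)
Lemma PH_rep_exists :
  exists rho : rep (PH F T) N, rho (Py F hw hwq) = Y /\ rho (Pz F hw hwq) = Z.
Proof.
pose lin := GRing.isLinear.Build F (PH F T) 'M[F]_N *:%R PH_lift
  (fun c x y => etrans (PH_liftD _ _) (congr1 (fun t => t + _) (PH_liftZ c x))).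
pose mon := GRing.isMonoidMorphism.Build (PH F T) 'M[F]_N PH_lift (PH_lift1, PH_liftM).
pose rho : rep (PH F T) N := HB.pack PH_lift lin mon.
by exists rho; split; [exact: PH_lift_y | exact: PH_lift_z].
Qed.
End Universal.

(** * Indecomposable representations *)

Section Reps.
Context {F : fieldType} {P : algType F} (y z : P).
Hypothesis gen : forall Q : P -> Prop, Q 1 -> Q y -> Q z ->
  (forall a b, Q a -> Q b -> Q (a + b)) -> (forall c a, Q a -> Q (c *: a)) ->
  (forall a b, Q a -> Q b -> Q (a * b)) -> forall x, Q x.

Lemma repZ N (rho : rep P N) c x : rho (c *: x) = c *: rho x.
Proof. exact: linearZ_LR. Qed.

Lemma repM N (rho : rep P N) a b : rho (a * b) = rho a * rho b.
Proof. exact: rmorphM. Qed.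
Lemma repX N (rho : rep P N) a k : rho (a ^+ k) = rho a ^+ k.
Proof. exact: rmorphXn. Qed.

Lemma rep_intertwine M N (rho : rep P M) (sigma : rep P N) (f : 'M[F]_(N, M)) :
  f *m rho y = sigma y *m f -> f *m rho z = sigma z *m f ->
  forall x, f *m rho x = sigma x *m f.
Proof.
move=> fy fz; apply: gen => // [|a b fa fb|c a fa|a b fa fb].
- by rewrite !rmorph1 mulmx1 mul1mx.
- by rewrite (rmorphD rho) (rmorphD sigma) mulmxDr mulmxDl fa fb.
- by rewrite !repZ -scalemxAr -scalemxAl fa.
- rewrite !rmorphM /= -[rho a * _]/(_ *m _) -[sigma a * _]/(_ *m _).
  by rewrite mulmxA fa -mulmxA fb mulmxA.
Qed.

Lemma subrep_yz N (rho : rep P N) (U : {vspace 'cV[F]_N}) :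
  (forall u, u \in U -> rho y *m u \in U) -> (forall u, u \in U -> rho z *m u \in U) ->
  subrep rho U.
Proof.
move=> Uy Uz; apply: gen => // [u|a b Ua Ub u uU|c a Ua u uU|a b Ua Ub u uU].
- by rewrite rmorph1 mul1mx.
- by rewrite (rmorphD rho) mulmxDl memvD ?Ua ?Ub.
- by rewrite repZ -scalemxAl memvZ ?Ua.
- by rewrite rmorphM /= -[rho a * _]/(_ *m _) -mulmxA Ua ?Ub.
Qed.

Lemma rep_iso_dim M N (rho : rep P M) (sigma : rep P N) : rep_iso rho sigma -> M = N.
Proof.
move=> [f [f' [h h' _]]]; apply/eqP; rewrite eqn_leq; apply/andP; split.
  by have := mulmx_max_rank f' f; rewrite h' mxrank1.
by have := mulmx_max_rank f f'; rewrite h mxrank1.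
Qed.

Lemma rep_iso_scalar N (rho sigma : rep P N.+1) x a b :
  rep_iso rho sigma -> rho x = a%:M -> sigma x = b%:M -> a = b.
Proof.
move=> [f [f' [ff' _ fx]]] ra sb; have := fx x.
rewrite ra sb mul_mx_scalar mul_scalar_mx => /eqP.
rewrite -subr_eq0 -scalerBl scaler_eq0 subr_eq0 => /orP[/eqP//|/eqP f0].
by have /matrixP/(_ 0 0)/eqP := ff'; rewrite f0 mul0mx !mxE eq_sym oner_eq0.
Qed.

(** The space is the direct sum of the kernels of [1 - e] and [e], both of which are
    subrepresentations. *)
Lemma indecomposable_idem N (rho : rep P N) (e : 'M[F]_N) :
  indecomposable rho -> e *m e = e -> (forall x, e *m rho x = rho x *m e) ->
  e = 0 \/ e = 1%:M.
Proof.
move=> [_ ind] ee ec.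
pose ker (A : 'M[F]_N) : {vspace 'cV[F]_N} := lker (linfun (mulmx A)).
have kerP A u : (u \in ker A) = (A *m u == 0) by rewrite memv_ker lfunE.
have sub (A : 'M[F]_N) : (forall x, A *m rho x = rho x *m A) -> subrep rho (ker A).
  by move=> Ac x u; rewrite !kerP mulmxA Ac -mulmxA => /eqP->; rewrite mulmx0.
have mx0 (A : 'M[F]_N) : (forall u : 'cV_N, A *m u = 0) -> A = 0.
  move=> A0; apply/matrixP => i j; have /matrixP/(_ i 0) := A0 (delta_mx j 0).
  by rewrite -colE !mxE.
case: (ind (ker (1%:M - e)) (ker e)).
- by apply: sub => x; rewrite mulmxBl mulmxBr mul1mx mulmx1 ec.
- exact: sub.
- apply/eqP; rewrite eqEsubv subvf; apply/subvP => u _.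
  rewrite -[u](subrK (e *m u)) addrC; apply: memv_add; rewrite kerP.
    by rewrite mulmxBl mul1mx mulmxA ee subrr.
  by rewrite mulmxBr mulmxA ee subrr.
- apply/eqP; rewrite -subv0; apply/subvP => u; rewrite memv_cap !kerP memv0.
  by rewrite mulmxBl mul1mx => /andP[/eqP h /eqP eu]; move: h; rewrite eu subr0 => ->.
- move=> k0; left; apply: mx0 => u.
  have : e *m u \in ker (1%:M - e) by rewrite kerP mulmxBl mul1mx mulmxA ee subrr.
  by rewrite k0 memv0 => /eqP.
- move=> k0; right; apply/esym/eqP; rewrite -subr_eq0; apply/eqP/mx0 => u.
  have : (1%:M - e) *m u \in ker e by rewrite kerP mulmxA mulmxBr mulmx1 ee subrr mul0mx.
  by rewrite k0 memv0 => /eqP.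
Qed.

(** [s *m p] is an idempotent endomorphism, nonzero because [sigma] has positive dimension, hence it
    is the identity. *)
Lemma indecomposable_retract M N (rho : rep P N) (sigma : rep P M.+1)
    (s : 'M[F]_(N, M.+1)) (p : 'M[F]_(M.+1, N)) :
  indecomposable rho -> s *m sigma y = rho y *m s -> s *m sigma z = rho z *m s ->
  p *m rho y = sigma y *m p -> p *m rho z = sigma z *m p -> p *m s = 1%:M ->
  rep_iso rho sigma.
Proof.
move=> ind sy sz py pz ps.
have sx := rep_intertwine sy sz; have px := rep_intertwine py pz.
case: (indecomposable_idem (e := s *m p) ind).
- by rewrite -mulmxA [p *m (s *m p)]mulmxA ps mul1mx.
- by move=> x; rewrite -mulmxA px mulmxA sx mulmxA.
- move=> sp0; have : p *m (s *m p) *m s = 0 by rewrite sp0 mulmx0 mul0mx.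
  rewrite mulmxA ps mul1mx ps => /matrixP/(_ 0 0)/eqP.
  by rewrite !mxE oner_eq0.
- by move=> sp; exists p, s; split.
Qed.

Lemma indecomposable_scalar N (rho : rep P N) (sigma : rep P 1) a b :
  indecomposable rho -> rho y = a%:M -> rho z = b%:M ->
  sigma y = a%:M -> sigma z = b%:M -> rep_iso rho sigma.
Proof.
move=> ind ry rz sy sz; have [N0 _] := ind; pose o := Ordinal N0.
apply: (@indecomposable_retract 0 N rho sigma (delta_mx o 0) (delta_mx 0 o)) => //.
- by rewrite ry sy mul_mx_scalar mul_scalar_mx.
- by rewrite rz sz mul_mx_scalar mul_scalar_mx.
- by rewrite ry sy mul_mx_scalar mul_scalar_mx.
- by rewrite rz sz mul_mx_scalar mul_scalar_mx.
- by rewrite mul_delta_mx; apply/matrixP => i j; rewrite !ord1 !mxE.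
Qed.

Lemma delta01_block : delta_mx 0 1 = block_mx 0 1%:M 0 0 :> 'M[F]_(1 + 1).
Proof.
apply/matrixP => i j; case: (@split_ordP 1 1 i) => i' ->; case: (@split_ordP 1 1 j) => j' ->.
- by rewrite block_mxEul !mxE !ord1.
- by rewrite block_mxEur !mxE !ord1.
- by rewrite block_mxEdl !mxE !ord1.
- by rewrite block_mxEdr !mxE !ord1.
Qed.

(** A vector [v] with [Z v] nonzero spans, together with [Z v], a copy of [sigma]; the rows [p0] and
    [xi *m Z] are the dual coordinates of [Z v] and [v]. *)
Lemma indecomposable_nilp N (rho : rep P N) (sigma : rep P 2) a :
  indecomposable rho -> rho y = a%:M -> rho z *m rho z = 0 -> rho z != 0 ->
  sigma y = a%:M -> sigma z = delta_mx 0 1 -> rep_iso rho sigma.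
Proof.
move=> ind ry zz /matrix0Pn[i [j zij]] sy sz; set Z := rho z in zz zij *.
pose v : 'cV[F]_N := delta_mx j 0; pose xi : 'rV[F]_N := (Z i j)^-1 *: delta_mx 0 i.
have xZv : xi *m Z *m v = 1%:M.
  rewrite /xi -!scalemxAl -rowE -colE; apply/matrixP => k l.
  by rewrite !ord1 !mxE mulVf.
(* The correction makes [p0] vanish on [v], and leaves [xi *m Z] unchanged because [Z] squares to
   zero. *)
pose p0 := xi - xi *m v *m (xi *m Z).
have p0v : p0 *m v = 0 by rewrite mulmxBl -[_ *m _ *m v]mulmxA xZv mulmx1 subrr.
have p0Z : p0 *m Z = xi *m Z by rewrite mulmxBl -!mulmxA zz !mulmx0 subr0.
apply: (@indecomposable_retract 1 N rho sigma (row_mx (Z *m v) v : 'M_(N, 1 + 1))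
  (col_mx p0 (xi *m Z) : 'M_(1 + 1, N))) => //.
- by rewrite ry sy mul_mx_scalar mul_scalar_mx.
- rewrite sz delta01_block.
  rewrite -[LHS]/(@mulmx F N (1 + 1) (1 + 1) (row_mx _ _) (block_mx _ _ _ _)).
  rewrite -[RHS]/(@mulmx F N N (1 + 1) Z (row_mx _ _)) mul_mx_row mul_row_block.
  by rewrite !mulmx0 !addr0 mulmx1 mulmxA zz mul0mx.
- by rewrite ry sy mul_mx_scalar mul_scalar_mx.
- rewrite sz delta01_block.
  rewrite -[RHS]/(@mulmx F (1 + 1) (1 + 1) N (block_mx _ _ _ _) (col_mx _ _)).
  rewrite -[LHS]/(@mulmx F (1 + 1) N N (col_mx _ _) Z) mul_col_mx mul_block_col.
  by rewrite !mul0mx mul1mx add0r addr0 p0Z -mulmxA zz mulmx0.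
- rewrite -[LHS]/(@mulmx F (1 + 1) N (1 + 1) (col_mx _ _) (row_mx _ _)).
  rewrite mul_col_row p0v mulmxA p0Z xZv -mulmxA [Z *m (Z *m v)]mulmxA.
  by rewrite zz mul0mx mulmx0 -scalar_mx_block.
Qed.

Lemma cV1_subspace (U : {vspace 'cV[F]_1}) : U = 0%VS \/ U = fullv.
Proof.
have [->|U0] := eqVneq U 0%VS; [by left | right; apply/eqP].
by rewrite eqEdim subvf dimvf /dim /= muln1; move: U0; rewrite -dimv_eq0 lt0n.
Qed.

Lemma rep1_irreducible (rho : rep P 1) : irreducible rho.
Proof. by split=> // U _; exact: cV1_subspace. Qed.

Lemma rep1_indecomposable (rho : rep P 1) : indecomposable rho.
Proof.
split=> // U W _ _ _ UW0; case: (cV1_subspace U) => hU; [by left | right].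
by rewrite -UW0 hU capfv.
Qed.

Section Jordan2.
Context (rho : rep P 2) (a : F) (ry : rho y = a%:M) (rz : rho z = delta_mx 0 1).

(** For a nonzero [u] in [U], either [z u] is a nonzero multiple of the first basis vector or [u]
    itself is one. Hence two nonzero subrepresentations always meet. *)
Lemma jordan2_kernel (U : {vspace 'cV[F]_2}) :
  subrep rho U -> U = 0%VS \/ (delta_mx 0 0 : 'cV[F]_2) \in U.
Proof.
move=> sU; have [->|U0] := eqVneq U 0%VS; [by left | right].
have uU := memv_pick U; have := U0; rewrite -vpick0; set u := vpick U in uU *.
move=> u0; have rzu : rho z *m u = u 1 0 *: delta_mx 0 0.
  rewrite rz; apply/matrixP => i j; rewrite !ord1 !mxE big_ord_recl big_ord1 !mxE /=.
  rewrite andbF mul0r add0r andbT mulr_natl mulr_natr.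
  by congr (_ *+ _); congr (u _ _); apply: val_inj.
have [u1|u1] := eqVneq (u 1 0) 0; last first.
  have := sU z _ uU; rewrite rzu => /(memvZ (u 1 0)^-1).
  by rewrite scalerA mulVf ?scale1r.
have uE : u = u 0 0 *: delta_mx 0 0.
  apply/matrixP => i j; rewrite !ord1 !mxE; case: i => -[|[|//]] hi /=.
    by rewrite mulr1; congr (u _ _); apply: val_inj.
  by rewrite mulr0 -u1; congr (u _ _); apply: val_inj.
have u00 : u 0 0 != 0 by apply: contra u0 => /eqP u00; rewrite uE u00 scale0r.
by have := memvZ (u 0 0)^-1 uU; rewrite [X in _ *: X]uE scalerA mulVf ?scale1r.
Qed.

Lemma jordan2_indecomposable : indecomposable rho.
Proof.
split=> // U W sU sW _ UW0.
case: (jordan2_kernel sU) => [|hU]; [by left|].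
case: (jordan2_kernel sW) => [|hW]; [by right|].
have : (delta_mx 0 0 : 'cV[F]_2) \in (U :&: W)%VS by rewrite memv_cap hU hW.
by rewrite UW0 memv0 => /eqP/matrixP/(_ 0 0)/eqP; rewrite !mxE oner_eq0.
Qed.

Lemma jordan2_reducible : ~ irreducible rho.
Proof.
pose e0 : 'cV[F]_2 := delta_mx 0 0.
move=> [_ /(_ <[e0]>%VS)].
case=> [|h|h].
- apply: subrep_yz => u /vlineP[c ->]; rewrite -scalemxAr.
    by rewrite ry mul_scalar_mx !memvZ ?memv_line.
  rewrite rz /e0 mul_delta_mx_0 // scaler0 mem0v.
- by [].
- have := memv_line e0; rewrite h memv0.
  by move=> /eqP/matrixP/(_ 0 0)/eqP; rewrite !mxE oner_eq0.
- have := dim_vline e0; rewrite h dimvf /dim /=.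
  by case: (_ == _).
Qed.
End Jordan2.
End Reps.

Lemma scalar_mxX (R : comNzRingType) N (a : R) k : a%:M ^+ k = (a ^+ k)%:M :> 'M_N.
Proof.
elim: k => [|k IH]; first by rewrite !expr0.
by rewrite !exprS IH -[LHS]/(_ *m _) -scalar_mxM.
Qed.

(** * The action of [y] and [z] on an indecomposable representation *)

Section Classification.
Context {F : fieldType} {P : algType F} (y z : P).
Hypothesis gen : forall Q : P -> Prop, Q 1 -> Q y -> Q z ->
  (forall a b, Q a -> Q b -> Q (a + b)) -> (forall c a, Q a -> Q (c *: a)) ->
  (forall a b, Q a -> Q b -> Q (a * b)) -> forall x, Q x.
Context (n d : nat) (hdn : (d %| n)%N) (w : F) (hw : n.-primitive_root w).
Local Notation m := (n %/ d)%N.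

Lemma d_neq0 : d%:R != 0 :> F.
Proof.
apply: contra (natn_neq0 hw) => /eqP d0.
by rewrite -(divnK hdn) natrM d0 mulr0.
Qed.

(** The origin of the dichotomy on [k]: this is a character sum for the primitive d-th root of unity
    [w ^+ m]. *)
Lemma sum_prim_root_div k :
  \sum_(j < d) (w ^+ k) ^+ (j * m) = if (d %| k)%N then d%:R else 0.
Proof.
have n0 := prim_order_gt0 hw.
have hd := dvdn_prim_root hw hdn; rewrite -(sum_prim_rootX hd).
by apply: eq_bigr => j _; rewrite -!exprM; congr (_ ^+ _); ring.
Qed.

Lemma sum_scalar_mx N k (Z : 'M[F]_N) :
  \sum_(j < d) (w ^+ k)%:M ^+ (j * m) * Z = (if (d %| k)%N then d%:R else 0) *: Z.
Proof.
rewrite -sum_prim_root_div scaler_suml; apply: eq_bigr => j _.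
by rewrite scalar_mxX -[_ * Z]/(_ *m Z) mul_scalar_mx.
Qed.

Hypothesis (yn : y ^+ n = 1) (yz : y * z = z * y).
Hypothesis zz : z * z = \sum_(j < d) y ^+ (j * m) * z.

Lemma rep_yn N (rho : rep P N) : rho y ^+ n = 1.
Proof. by rewrite -rmorphXn yn rmorph1. Qed.

Lemma indecomposable_y N (rho : rep P N) : indecomposable rho ->
  exists k : 'I_n, rho y = (w ^+ k)%:M.
Proof.
move=> ind; have [N0 _] := ind.
have h k : eproj n w (rho y) k = 0 \/ eproj n w (rho y) k = 1%:M.
  apply: (indecomposable_idem ind); first exact: (eproj_idem hw (rep_yn rho)).
  apply: (rep_intertwine gen); apply: eproj_comm => //.
  by rewrite -[_ *m _]/(_ * _) -[RHS]/(_ * _) -!rmorphM yz.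
have [k hk] : exists k : 'I_n, eproj n w (rho y) k != 0.
  apply/existsP; apply: contraT; rewrite negb_exists => /forallP h0.
  have := @sum_eproj _ _ _ hw _ (rho y).
  rewrite big1 => [|k _]; last by apply/eqP; have := h0 k; rewrite negbK.
  move/matrixP/(_ (Ordinal N0) (Ordinal N0))/eqP.
  by rewrite !mxE eqxx eq_sym oner_eq0.
exists k; case: (h k) => hk1; first by rewrite hk1 eqxx in hk.
by have := mul_eproj hw (rep_yn rho) k; rewrite hk1 mulmx1 scalemx1.
Qed.

Lemma indecomposable_z N (rho : rep P N) (k : 'I_n) :
  indecomposable rho -> rho y = (w ^+ k)%:M ->
  if (d %| k)%N then rho z = 0 \/ rho z = d%:R%:M else rho z *m rho z = 0.
Proof.
move=> ind ry.
have rzz : rho z *m rho z = (if (d %| k)%N then d%:R else 0) *: rho z.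
  rewrite -[_ *m _]/(_ * _) -rmorphM zz rmorph_sum -sum_scalar_mx.
  by apply: eq_bigr => j _; rewrite -[LHS]/(rho (y ^+ (j * m) * z)) repM repX ry.
case: ifP rzz => dk rzz; last by rewrite rzz scale0r.
case: (indecomposable_idem (e := d%:R^-1 *: rho z) ind).
- rewrite -scalemxAl -scalemxAr rzz [_^-1 *: (d%:R *: _)]scalerA.
  by rewrite mulVf ?d_neq0 // scale1r.
- apply: (rep_intertwine gen); last by rewrite -scalemxAl -scalemxAr.
  by rewrite ry mul_mx_scalar mul_scalar_mx.
- by move/eqP; rewrite scaler_eq0 invr_eq0 (negPf d_neq0) => /eqP; left.
- by move/(congr1 ( *:%R d%:R)); rewrite scalerA mulfV ?d_neq0 // scale1r scalemx1; right.
Qed.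
End Classification.

(** * Counting the indices *)

Lemma card_ord_dvd n d : (0 < d)%N -> (d %| n)%N ->
  #|{: {k : 'I_n | (d %| k)%N}}| = (n %/ d)%N.
Proof.
(* [divn_count_dvd] counts multiples of [d] from 1 to [n], the left side those from 0 to [n - 1];
   the multiple [n] is traded for 0. *)
move=> d0 dn; rewrite card_sig -sum1_card (divn_count_dvd d n).
case: n dn => [|n] dn; first by rewrite big_geq // big_pred0 // => -[].
rewrite big_add1 /= big_nat_recr //= dn.
rewrite big_mkcond (eq_bigr (fun i : 'I_n.+1 => (d %| i)%N : nat)) => [|i _]; last first.
  by rewrite -topredE /=; case: (_ %| _)%N.
by rewrite big_ord_recl /= dvdn0 big_mkord addnC.
Qed.

Lemma card_ord_ndvd n d : (0 < d)%N -> (d %| n)%N ->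
  #|{: {k : 'I_n | ~~ (d %| k)%N}}| = (n - n %/ d)%N.
Proof.
move=> d0 dn; rewrite -(card_ord_dvd d0 dn) !card_sig.
have := cardC [pred k : 'I_n | (d %| k)%N]; rewrite card_ord => e.
rewrite -[X in (X - _)%N]e addKn.
by apply: eq_card => k; rewrite !inE.
Qed.

(** * Complex roots of unity *)

Section Omega.
Context (R : realType).

Lemma omegaCX n k : omegaC R n k = omegaC R n 1 ^+ k.
Proof.
elim: k => [|k IH].
  by rewrite expr0 /omegaC mul0r mul0r cos0 sin0.
rewrite exprS -IH /omegaC.
set t := 1.*2%:R * pi / n%:R.
have -> : k.+1.*2%:R * pi / n%:R = t + k.*2%:R * pi / n%:R.
  by rewrite /t doubleS -[k.*2.+2]/(2 + k.*2)%N natrD !mulrDl.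
by rewrite cosD sinD [sin t * _ + _]addrC.
Qed.

(** For [0 < j < n] the real part of the j-th power is [1 - 2 sin^2 (j pi / n)], which is below 1 as
    the angle lies strictly between 0 and pi. *)
Lemma omegaC_prim n : (0 < n)%N -> n.-primitive_root (omegaC R n 1).
Proof.
move=> n0; apply/andP; split=> //; apply/forallP => i; rewrite unity_rootE -omegaCX.
have n0' : n%:R != 0 :> R by rewrite pnatr_eq0 -lt0n.
have dbl k : k.*2%:R * pi / n%:R = (k%:R * pi / n%:R) *+ 2 :> R.
  by rewrite -mul2n natrM -!mulrA mulr_natl.
have [->|ni] := eqVneq i.+1 n.
  rewrite eqb_id /omegaC dbl mulrAC mulfV // mul1r cos2pi sin2pi.
  exact/eqP.
rewrite eqbF_neg eq_complex negb_and; apply/orP; left.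
rewrite /= dbl cos_mulr2n cos2sin2 mulrnBl.
set x := _ / _.
have x0 : 0 < sin x.
  have ltin : (i.+1 < n)%N by rewrite ltn_neqAle ni /=; exact: ltn_ord.
  have np : 0 < n%:R :> R by rewrite ltr0n.
  apply: sin_gt0_pi; rewrite divr_gt0 ?mulr_gt0 ?pi_gt0 ?ltr0n //=.
  by rewrite ltr_pdivrMr // mulrC ltr_pM2l ?pi_gt0 // ltr_nat.
apply: contra (lt0r_neq0 (exprn_gt0 2 x0)) => /eqP h; apply/eqP; lra.
Qed.
End Omega.

Theorem proposition6p3 (R : realType) (K : closedFieldType)
    (charK : [pchar K] =i pred0)
    (n d : nat) (hn : (1 < n)%N) (hd : (1 < d)%N) (hdn : (d %| n)%N)
    (q : K) (hq : d.-primitive_root q)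
    (w : K) (hw : n.-primitive_root w) (hwq : w ^+ (n %/ d) = q) :
  let m := (n %/ d)%N in
  let T := Taft hn hd hdn hq in
  let P : algType R[i] := PH R[i] T in
  let y : P := Py R[i] (T := T) hw hwq in
  let z : P := Pz R[i] (T := T) hw hwq in
  exists (C0 : 'I_n -> rep P 1)
         (Cd : {k : 'I_n | (d %| k)%N} -> rep P 1)
         (V : {k : 'I_n | ~~ (d %| k)%N} -> rep P 2),
    let L (a : 'I_n + {k : 'I_n | (d %| k)%N}) : rep P 1 :=
      match a with inl k => C0 k | inr k => Cd k end in
    [/\ [/\ forall k, C0 k y = (omegaC R n k)%:M /\ C0 k z = 0,
            forall k, Cd k y = (omegaC R n (val k))%:M /\ Cd k z = (d%:R)%:M
          & forall k, V k y = (omegaC R n (val k))%:M /\ V k z = delta_mx 0 1],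
        [/\ #|{: 'I_n + {k : 'I_n | (d %| k)%N}}| = (n + m)%N,
            forall a, irreducible (L a)
          & forall a b, rep_iso (L a) (L b) -> a = b],
        [/\ #|{: {k : 'I_n | ~~ (d %| k)%N}}| = (n - m)%N,
            forall k, ~ irreducible (V k),
            forall k, indecomposable (V k)
          & forall k l, rep_iso (V k) (V l) -> k = l]
      & [/\ forall a, indecomposable (L a),
            forall a k, ~ rep_iso (L a) (V k)
          & forall N (rho : rep P N), indecomposable rho ->
              (exists a, rep_iso rho (L a)) \/ (exists k, rep_iso rho (V k))]].
Proof.
move=> m T P y z.
have n0 : (0 < n)%N by exact: ltnW.
have d0 : (0 < d)%N by exact: ltnW.
have hom := omegaC_prim R n0; set om := omegaC R n 1 in hom.
have gen := @PH_gen K T w hw hwq R[i].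
have yn : y ^+ n = 1 := @Py_n K T w hw hwq R[i].
have yz : y * z = z * y := @Pyz K T w hw hwq R[i].
have zz : z * z = \sum_(j < d) y ^+ (j * m) * z := @Pzz K T w hw hwq R[i].
have dn0 : d%:R != 0 :> R[i] := d_neq0 hdn hom.
(* Once [y] acts by a scalar, the relations reduce to a single equation on [Z], satisfied by 0, by
   the scalar [d], or by the nilpotent block. *)
have ex N (Z : 'M[R[i]]_N) (k : nat) :
    Z * Z = (if (d %| k)%N then d%:R else 0) *: Z ->
    exists rho : rep P N, rho y = (omegaC R n k)%:M /\ rho z = Z.
  move=> ZZ; apply: (@PH_rep_exists K T w hw hwq).
  - by rewrite scalar_mxX omegaCX exprAC (prim_expr_order hom) expr1n.
  - by rewrite -[_ * _]/(_ *m _) -[RHS]/(_ *m _) mul_mx_scalar mul_scalar_mx.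
  - by rewrite ZZ omegaCX -(sum_scalar_mx hdn hom).
have om_inj (k l : 'I_n) : omegaC R n k = omegaC R n l -> k = l.
  rewrite omegaCX [in RHS]omegaCX => /eqP; rewrite (eq_prim_root_expr hom).
  by rewrite !modn_small // => /eqP/val_inj.
have exC0 (k : 'I_n) : exists rho : rep P 1, rho y = (omegaC R n k)%:M /\ rho z = 0.
  by apply: ex; rewrite mulr0 scaler0.
have exCd (k : {k : 'I_n | (d %| k)%N}) :
    exists rho : rep P 1, rho y = (omegaC R n (val k))%:M /\ rho z = (d%:R)%:M.
  by apply: ex; rewrite (valP k) -[_ * _]/(_ *m _) mul_scalar_mx.
have exV (k : {k : 'I_n | ~~ (d %| k)%N}) :
    exists rho : rep P 2, rho y = (omegaC R n (val k))%:M /\ rho z = delta_mx 0 1.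
  by apply: ex; rewrite (negPf (valP k)) scale0r -[_ * _]/(_ *m _) mul_delta_mx_0.
have [C0 C0E] := choice exC0; have [Cd CdE] := choice exCd; have [V VE] := choice exV.
exists C0, Cd, V => L.
pose idx (a : 'I_n + {k : 'I_n | (d %| k)%N}) : 'I_n :=
  match a with inl k => k | inr k => val k end.
have Ly a : L a y = (omegaC R n (idx a))%:M.
  by case: a => k /=; [case: (C0E k) | case: (CdE k)].
split; split=> //.
- by rewrite card_sum card_ord card_ord_dvd.
- by move=> a; exact: rep1_irreducible.
(* The scalar of [y] determines [k]; the scalar of [z], 0 or [d], tells the two families apart. *)
- move=> a b ab; have ij := om_inj _ _ (rep_iso_scalar ab (Ly a) (Ly b)).
  case: a b ab ij => [k|k] [l|l] /= ab.
  + by move->.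
  + have := rep_iso_scalar (x := z) ab (a := 0) (b := d%:R).
    rewrite (C0E k).2 (CdE l).2 raddf0 => /(_ erefl erefl)/eqP.
    by rewrite eq_sym (negPf dn0).
  + have := rep_iso_scalar (x := z) ab (a := d%:R) (b := 0).
    rewrite (C0E l).2 (CdE k).2 raddf0 => /(_ erefl erefl)/eqP.
    by rewrite (negPf dn0).
  + by move=> kl; congr inr; apply: val_inj.
- exact: card_ord_ndvd.
- by move=> k; have [Vy Vz] := VE k; exact: jordan2_reducible gen _ _ Vy Vz.
- by move=> k; have [Vy Vz] := VE k; exact: jordan2_indecomposable Vz.
- move=> k l kl; apply/val_inj/om_inj.
  exact: rep_iso_scalar kl (VE k).1 (VE l).1.
- by move=> a; exact: rep1_indecomposable.
- by move=> a k /rep_iso_dim.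
- move=> N rho ind.
  have [k] := indecomposable_y gen hom yn yz ind; rewrite -omegaCX => rk.
  have := indecomposable_z gen hdn hom zz ind; rewrite -/m.
  move=> /(_ k); rewrite -omegaCX => /(_ rk).
  case: ifPn => dk; first case=> rz.
  + left; exists (inl k); apply: (indecomposable_scalar gen ind rk (b := 0)).
    * by rewrite rz raddf0.
    * exact: (C0E k).1.
    * by rewrite /= (C0E k).2 raddf0.
  + left; exists (inr (exist _ k dk)).
    by apply: (indecomposable_scalar gen ind rk rz); case: (CdE (exist _ k dk)).
  + move=> rz2; have [rz|rz] := eqVneq (rho z) 0.
      left; exists (inl k); apply: (indecomposable_scalar gen ind rk (b := 0)).
      * by rewrite rz raddf0.
      * exact: (C0E k).1.
      * by rewrite /= (C0E k).2 raddf0.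
    right; exists (exist _ k dk); have [Vy Vz] := VE (exist _ k dk).
    exact: (indecomposable_nilp gen ind rk rz2 rz Vy Vz).
Qed.
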